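(* Let $\mathbb S$ be an o-minimal expansion of $\mathbb M$. Suppose that $\mathbb M$ has definable Skolem functions. Let $X$ be a Hausdorff definable space. Then the following are equivalent: (1) $X$ is definably compact. (2) $X$ is $\mathbb S$-definably compact.
   Context: $\mathbb M=(M,<,\ldots)$ is an arbitrary o-minimal structure; ''definable'' means definable in $\mathbb M$, possibly with parameters. $\mathbb M$ has definable Skolem functions if for every uniformly definable family $\{F_t\}_{t\in T}$ of nonempty definable sets there is a definable map $f:T\to\bigcup_t F_t$ with $f(t)\in F_t$ for all $t\in T$. A definable space is a set $X=\bigcup_{i\le k}X_i$ with injections (definable charts) $\theta_i:X_i\to M^{n_i}$ ($i\le k$, $k$ finite) such that each $\theta_i(X_i)$ is a definable subset of $M^{n_i}$ (with the induced topology), each $\theta_i(X_i\cap X_j)$ is an open definable subset of $\theta_i(X_i)$, and each transition map $\theta_j\circ\theta_i^{-1}:\theta_i(X_i\cap X_j)\to\theta_j(X_i\cap X_j)$ is a definable homeomorphism. $X$ carries the topology in which each $X_i$ is open and each $\theta_i$ is a homeomorphism. A map $f:X\to Y$ between definable spaces with charts $(X_i,\theta_i)$, $(Y_j,\delta_j)$ is definable if each $\delta_j\circ f\circ\theta_i^{-1}$ (on its natural domain) is a definable map between definable sets. A definable curve in $X$ is a continuous definable map $\alpha:(a,b)\to X$, with $a<b$ in $M\cup\{-\infty,+\infty\}$; it is completable in $X$ if both limits $\lim_{t\to a^+}\alpha(t)$ and $\lim_{t\to b^-}\alpha(t)$ exist in $X$. $X$ is definably compact if every definable curve in $X$ is completable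 in $X$. If $\mathbb S$ is an o-minimal expansion of $\mathbb M$ (same underlying ordered set, more definable sets), a definable space $X$ is also an $\mathbb S$-definable space; the prefix ''$\mathbb S$-'' means that the notion is taken in the structure $\mathbb S$. *)

(* Defs.v *)
From HB Require Import structures.
From mathcomp Require Import all_boot all_order all_algebra.
From mathcomp Require Import boolp classical_sets set_interval topology.

Set Implicit Arguments.
Unset Strict Implicit.
Unset Printing Implicit Defensive.

Import Order.TTheory.

Local Open Scope ring_scope.
Local Open Scope order_scope.
Local Open Scope classical_set_scope.

(* A structure (M, <, ...): the order is that of [M]; the record holds the
   signature of the remaining symbols together with their interpretation.     *)
Record structure (M : Type) := Structure {
  fsym : Type;
  farity : fsym -> nat;
  finterp : forall f : fsym, 'rV[M]_(farity f) -> M;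
  rsym : Type;
  rarity : rsym -> nat;
  rinterp : forall r : rsym, set 'rV[M]_(rarity r) }.

Section Formulas.
Context {d : Order.disp_t} {M : orderType d} (S : structure M).

(* [Par c] is a constant symbol for the element [c]: this is how formulas get
   parameters.                                                                *)
Inductive term (n : nat) : Type :=
| Var of 'I_n
| Par of M
| App (f : fsym S) of ('I_(farity f) -> term n).

(* [Ex phi] quantifies the last of the [n + 1] variables of [phi].            *)
Inductive formula (n : nat) : Type :=
| Eq of term n & term n
| Lt of term n & term n
| Rel (r : rsym S) of ('I_(rarity r) -> term n)
| Not of formula n
| And of formula n & formula n
| Ex of formula (n + 1)%N.

Fixpoint eval n (v : 'rV[M]_n) (t : term n) : M :=
  match t with
  | Var i => v ord0 i
  | Par c => c
  | App f ts => finterp (\row_j eval v (ts j))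
  end.

Fixpoint sat n (v : 'rV[M]_n) (phi : formula n) {struct phi} : Prop :=
  match phi with
  | Eq t u => eval v t = eval v u
  | Lt t u => eval v t < eval v u
  | Rel r ts => rinterp (\row_j eval v (ts j))
  | Not psi => ~ sat v psi
  | And psi chi => sat v psi /\ sat v chi
  | Ex psi => exists c : M, sat (row_mx v (const_mx c : 'rV_1)) psi
  end.

Definition definable n (A : set 'rV[M]_n) : Prop :=
  exists phi : formula n, A = [set v | sat v phi].

(* Functions are total in Rocq: only the values of [f] on [A] matter.         *)
Definition definable_map m n (A : set 'rV[M]_m) (f : 'rV[M]_m -> 'rV[M]_n) :
  Prop := definable A /\ definable [set row_mx v (f v) | v in A].

(* The family [F_t], [t] in [T], is uniformly definable when
   [{(t, y) | t in T, y in F_t}] is definable.                                *)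
Definition has_definable_skolem : Prop :=
  forall (m n : nat) (T : set 'rV[M]_m) (F : 'rV[M]_m -> set 'rV[M]_n),
    definable T ->
    definable [set u | exists t y, [/\ T t, F t y & u = row_mx t y]] ->
    (forall t, T t -> F t !=set0) ->
    exists f : 'rV[M]_m -> 'rV[M]_n,
      definable_map T f /\ forall t, T t -> F t (f t).

(* The underlying order is dense without endpoints, and every definable subset
   of [M] is a finite union of points and of open intervals with endpoints in
   [M] or infinite.                                                           *)
Record o_minimal : Prop := OMinimal {
  omin_inhabited : exists x : M, True;
  omin_dense : forall x y : M, x < y -> exists z, x < z < y;
  omin_nomin : forall x : M, exists y, y < x;
  omin_nomax : forall x : M, exists y, x < y;
  omin_definable : forall A : set M,
    definable [set (const_mx x : 'rV_1) | x in A] ->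
    exists (s : seq M) (t : seq (interval M)),
      (forall i, i \in t -> itv_open_ends i) /\
      A = [set` s] `|` \bigcup_(i in [set` t]) [set` i] }.

End Formulas.

(* More definable sets on the same ordered set; the signatures may be unrelated. *)
Definition expansion d (M : orderType d) (S S' : structure M) : Prop :=
  forall n (A : set 'rV[M]_n), definable S A -> definable S' A.

(* The part of the definition of a definable space that depends only on the
   order of [M]; the definability requirements are in [definable_space] below,
   so that the same space can be considered in several structures. The charts
   are total functions, only their values on [dom i] matter. The functions of
   [transition_continuous] are the transition maps [chart j \o (chart i)^-1];
   applying the field to [i, j] and to [j, i] shows they are homeomorphisms.  *)
Record charted_space d (M : orderTopologicalType d) := ChartedSpace {
  carrier :> Type;
  ncharts : nat;
  dom : 'I_ncharts -> set carrier;
  dim : 'I_ncharts -> nat;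
  chart : forall i, carrier -> 'rV[M]_(dim i);
  dom_cover : \bigcup_i dom i = setT;
  chart_inj : forall i x y, dom i x -> dom i y -> chart i x = chart i y -> x = y;
  overlap_open : forall i j, exists2 V : set 'rV[M]_(dim i), open V &
    chart i @` (dom i `&` dom j) = chart i @` dom i `&` V;
  transition_continuous : forall i j,
    exists tau : 'rV[M]_(dim i) -> 'rV[M]_(dim j),
      (forall x, dom i x -> dom j x -> tau (chart i x) = chart j x) /\
      {within chart i @` (dom i `&` dom j), continuous tau} }.

Section ChartTopology.
Context {d : Order.disp_t} {M : orderTopologicalType d} (X : charted_space M).

HB.instance Definition _ := gen_eqMixin X.
HB.instance Definition _ := gen_choiceMixin X.

Definition chart_open (U : set X) : Prop :=
  forall i : 'I_(ncharts X), exists2 V : set 'rV[M]_(dim i), open V &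
    chart i @` (U `&` dom i) = chart i @` dom i `&` V.

Lemma chart_openT : chart_open setT.
Proof. by move=> i; exists setT; [exact: openT|rewrite setTI setIT]. Qed.

Lemma chart_openI : setI_closed chart_open.
Proof.
move=> U V Uo Vo i; have [U' U'o eU] := Uo i; have [V' V'o eV] := Vo i.
exists (U' `&` V'); first exact: openI.
apply/seteqP; split=> [_ [x [[Ux Vx] ix] <-]|_ [[x ix <-] [U'x V'x]]].
  have : (chart i @` dom i `&` U') (chart i x) by rewrite -eU; exists x.
  have : (chart i @` dom i `&` V') (chart i x) by rewrite -eV; exists x.
  by move=> [] _ ? [].
have : (chart i @` (U `&` dom i)) (chart i x) by rewrite eU; split=> //; exists x.
have : (chart i @` (V `&` dom i)) (chart i x) by rewrite eV; split=> //; exists x.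
move=> [y [Vy iy] /(chart_inj iy ix) yx] [z [Uz iz] /(chart_inj iz ix) zx].
by exists x => //; split=> //; split; [rewrite -zx|rewrite -yx].
Qed.

Lemma chart_open_bigU (I : Type) (f : I -> set X) :
  (forall k, chart_open (f k)) -> chart_open (\bigcup_k f k).
Proof.
move=> fo i.
pose V k := [set v | exists W : set 'rV[M]_(dim i), [/\ open W,
  chart i @` (f k `&` dom i) = chart i @` dom i `&` W & W v]].
exists (\bigcup_k V k).
  apply: bigcup_open => k _; rewrite openE => v [W [Wo eW Wv]].
  apply: (@filterS _ (nbhs v) _ W); last exact: open_nbhs_nbhs.
  by move=> w Ww; exists W.
apply/seteqP; split=> [_ [x [[k _ fx] ix] <-]|_ [[x ix <-] [k _ [W [_ eW Wx]]]]].
  split; first by exists x.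
  have [W Wo eW] := fo k i; exists k => //; exists W; split=> //.
  have : (chart i @` dom i `&` W) (chart i x) by rewrite -eW; exists x.
  by case.
have : (chart i @` dom i `&` W) (chart i x) by split=> //; exists x.
by rewrite -eW => -[y [fy iy] yx]; exists y => //; split=> //; exists k.
Qed.

HB.instance Definition _ :=
  isOpenTopological.Build X chart_openT chart_openI chart_open_bigU.

(* By the next two lemmas, this is the topology for which the [dom i] are open
   and the charts are homeomorphisms onto their images.                       *)
Lemma chart_openE (U : set X) : open U <-> chart_open U.
Proof.
split=> [Uo|Uo].
  suff -> : U = \bigcup_(W : {W : set X | chart_open W /\ W `<=` U}) proj1_sig W.
    by apply: chart_open_bigU => -[W []].
  apply/seteqP; split=> [x Ux|x [[W [Wo WU]] _ /= /WU]//].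
  have [W [Wo Wx WU]] : nbhs x U by exact: open_nbhs_nbhs.
  by exists (exist _ W (conj Wo WU)).
by rewrite openE => x Ux; exists U; split.
Qed.

Lemma dom_open (i : 'I_(ncharts X)) : open (dom i).
Proof. by apply/chart_openE => j; rewrite setIC; exact: overlap_open. Qed.

Lemma chart_homeo (i : 'I_(ncharts X)) (U : set X) : U `<=` dom i ->
  open U <-> exists2 V : set 'rV[M]_(dim i), open V &
    chart i @` U = chart i @` dom i `&` V.
Proof.
move=> Ui; rewrite chart_openE; split=> [/(_ i)|[V Vo eV] j].
  by rewrite (setIidl Ui).
have [tau [tauE tauc]] := transition_continuous j i.
have [W Wo eW] := overlap_open j i.
have [Z Zo eZ] : exists2 Z : set 'rV[M]_(dim j), open Z &
    chart j @` (dom j `&` dom i) `&` tau @^-1` V =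
    chart j @` (dom j `&` dom i) `&` Z.
  move: tauc => /continuousP /(_ V Vo) /open_subspaceP[Z Zo eZ].
  by exists Z => //; rewrite setIC -eZ setIC.
exists (W `&` Z); first exact: openI.
rewrite setIA -eW -eZ; apply/seteqP; split.
  move=> _ [x [Ux jx] <-]; have ix := Ui _ Ux.
  split; first by exists x.
  rewrite /preimage /= tauE//.
  have : (chart i @` dom i `&` V) (chart i x) by rewrite -eV; exists x.
  by case.
move=> _ [[x [jx ix] <-]]; rewrite /preimage /= tauE// => Vx.
have : (chart i @` U) (chart i x) by rewrite eV; split=> //; exists x.
by move=> [y Uy /(chart_inj (Ui _ Uy) ix) yx]; exists x => //; split=> //; rewrite -yx.
Qed.

End ChartTopology.

Section DefinableSpaces.
Context {d : Order.disp_t} {M : orderTopologicalType d}.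
Implicit Types (S : structure M) (X : charted_space M).

Definition definable_space S X : Prop :=
  forall i : 'I_(ncharts X), definable S (chart i @` dom i) /\
    forall j : 'I_(ncharts X), definable S (chart i @` (dom i `&` dom j)) /\
      definable S [set row_mx (chart i x) (chart j x) | x in dom i `&` dom j].

Lemma definable_space_expansion S S' X :
  expansion S S' -> definable_space S X -> definable_space S' X.
Proof.
move=> SS' hX i; have [hi hij] := hX i; split; first exact: SS'.
by move=> j; have [? ?] := hij j; split; exact: SS'.
Qed.

(* An interval [(a, b)] with [a < b] in [M] extended with two infinities.     *)
Definition open_itv (I : interval M) : Prop :=
  itv_open_ends I /\ let: Interval a b := I in a < b.

(* The filters of [t --> a^+] and of [t --> b^-], where [I] is [(a, b)].      *)
Definition at_left_end (I : interval M) : set_system M :=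
  filter_from [set` I] (fun c => [set t | t \in I /\ t < c]).
Definition at_right_end (I : interval M) : set_system M :=
  filter_from [set` I] (fun c => [set t | t \in I /\ c < t]).

(* Definability of [alpha] on [(a, b)], whose only chart is the inclusion in
   [M]: for each chart of [X], the map [chart j \o alpha] is definable on its
   natural domain.                                                            *)
Definition definable_curve S X (I : interval M) (alpha : M -> X) : Prop :=
  [/\ open_itv I, {within [set` I], continuous alpha} &
    forall j : 'I_(ncharts X),
      let D := [set t | t \in I /\ dom j (alpha t)] in
      definable S [set (const_mx t : 'rV_1) | t in D] /\
      definable S [set row_mx (const_mx t : 'rV_1) (chart j (alpha t)) | t in D]].

Definition completable X (I : interval M) (alpha : M -> X) : Prop :=
  (exists l : X, alpha @ at_left_end I --> l) /\
  (exists l : X, alpha @ at_right_end I --> l).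

Definition definably_compact S X : Prop :=
  forall (I : interval M) (alpha : M -> X),
    definable_curve S I alpha -> completable I alpha.

End DefinableSpaces.

(* Main.v *)
(* Let alpha be an S-definable curve in the definably compact space X, and E an end of its
   domain. By o-minimality of S there is a set J of charts containing alpha near E, the other
   ones avoiding alpha near E, and each coordinate of alpha in a chart of J has a one-sided
   limit K in M or at infinity. The sets B_w of the points x that lie in exactly the charts of J and
   whose coordinates are w-close to K form an M-definable family, each B_w being nonempty since it
   contains alpha near E. Thus a Skolem function of M picks b(w) in B_w. The parameters w form a
   tuple of elements of M, and by definable compactness in M one may let these tend to their
   limits one after the other, the outcome being a point l adherent to all the B_w. (A single
   definable curve would not do: curve selection may fail in this generality.) A chart around l
   must belong to J, whence the coordinates of l in it are the limits K and alpha tends to l.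
   Passing to the limit in one variable uses that M-definable functions are continuous near
   each end, i.e. a form of the monotonicity theorem.                         *)
From HB Require Import structures.
From mathcomp Require Import all_boot all_order all_algebra.
From mathcomp Require Import boolp classical_sets set_interval filter topology.
Require Import Defs.

Set Implicit Arguments.
Unset Strict Implicit.
Unset Printing Implicit Defensive.

Import Order.TTheory.

Local Open Scope ring_scope.
Local Open Scope order_scope.
Local Open Scope classical_set_scope.

(** * Definable predicates on environments *)

Section Substitution.
Context {d : Order.disp_t} {M : orderType d} (S : structure M).

Fixpoint tsub n m (s : 'I_n -> 'I_m + M) (t : term S n) : term S m :=
  match t with
  | Var i => match s i with inl j => Var S j | inr c => Par S m c end
  | Par c => Par S m c
  | App f ts => App (fun j => tsub s (ts j))
  end.

(** [Ex] binds the last variable, so under a binder that variable goes to the last place of the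
    target and the image of any other one is weakened. *)
Definition sub_lift n m (s : 'I_n -> 'I_m + M) (i : 'I_(n + 1)%N) :
    'I_(m + 1)%N + M :=
  match split i with
  | inl j => match s j with inl k => inl (lshift 1 k) | inr c => inr c end
  | inr k => inl (rshift m k)
  end.

Fixpoint fsub n (phi : formula S n) : forall m, ('I_n -> 'I_m + M) -> formula S m :=
  match phi with
  | Eq t u => fun m s => Eq (tsub s t) (tsub s u)
  | Lt t u => fun m s => Lt (tsub s t) (tsub s u)
  | Rel r ts => fun m s => Rel (fun j => tsub s (ts j))
  | Not psi => fun m s => Not (fsub psi s)
  | And psi chi => fun m s => And (fsub psi s) (fsub chi s)
  | Ex psi => fun m s => Ex (fsub psi (sub_lift s))
  end.

Definition sub_val m (v : 'rV[M]_m) (x : 'I_m + M) : M :=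
  match x with inl j => v ord0 j | inr c => c end.

Lemma eval_tsub n m (s : 'I_n -> 'I_m + M) (t : term S n) (v : 'rV[M]_m) :
  eval v (tsub s t) = eval (\row_i sub_val v (s i)) t.
Proof.
elim: t => [i|//|f ts IH] /=; first by rewrite mxE; case: (s i).
by congr finterp; apply/rowP => j; rewrite !mxE.
Qed.

Lemma sat_fsub n (phi : formula S n) m (s : 'I_n -> 'I_m + M) (v : 'rV[M]_m) :
  sat v (fsub phi s) <-> sat (\row_i sub_val v (s i)) phi.
Proof.
elim: phi m s v => {n} [n t u|n t u|n r ts|n psi IH|n psi IH chi IH'|n psi IH] m s v /=.
- by rewrite !eval_tsub.
- by rewrite !eval_tsub.
- suff -> : (\row_j eval v (tsub s (ts j))) =
    \row_j eval (\row_i sub_val v (s i)) (ts j) by [].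
  by apply/rowP => j; rewrite !mxE eval_tsub.
- by rewrite IH.
- by rewrite IH IH'.
- suff E c : (\row_i sub_val (row_mx v (const_mx c : 'rV_1)) (sub_lift s i)) =
      row_mx (\row_i sub_val v (s i)) (const_mx c : 'rV_1).
    by split=> -[c]; [rewrite IH E|rewrite -E -IH] => h; exists c.
  apply/rowP => i; rewrite !mxE /sub_lift.
  by case: splitP => j ij; rewrite !mxE;
    [case: (s j) => [k|//] /=; rewrite row_mxEl|rewrite /= row_mxEr mxE].
Qed.

End Substitution.

Section DefinablePredicates.
Context {d : Order.disp_t} {M : orderType d} (S : structure M).

Local Notation env := (nat -> M).

(* Environments [e] give values to the variables; the quantifier lemmas below bind
   the variable [0], in the style of de Bruijn.                               *)
Definition dpred (P : env -> Prop) : Prop :=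
  exists n (phi : formula S n), forall e, P e <-> sat (\row_(i < n) e i) phi.

(** Variables and constants suffice as terms, because definable functions are handled through their
    graphs. *)
Inductive dterm : (env -> M) -> Prop :=
| dvar k : dterm (fun e => e k)
| dcst c : dterm (fun=> c).

Lemma dpred_ext (P Q : env -> Prop) : (forall e, P e <-> Q e) -> dpred P -> dpred Q.
Proof. by move=> PQ [n [phi h]]; exists n, phi => e; rewrite -PQ. Qed.

Lemma dpred_weaken (P : env -> Prop) : dpred P ->
  exists n, forall m, (n <= m)%N ->
    exists phi : formula S m, forall e, P e <-> sat (\row_(i < m) e i) phi.
Proof.
move=> [n [phi h]]; exists n => m nm.
exists (fsub phi (fun i => inl (widen_ord nm i))) => e.
rewrite h sat_fsub; set u := \row_i _; set v := \row_i _.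
by suff -> : u = v by []; apply/rowP => i; rewrite !mxE /= mxE.
Qed.

Lemma dpred_and (P Q : env -> Prop) :
  dpred P -> dpred Q -> dpred (fun e => P e /\ Q e).
Proof.
move=> /dpred_weaken[n hP] /dpred_weaken[m hQ].
have [phi hphi] := hP (maxn n m) (leq_maxl _ _).
have [psi hpsi] := hQ (maxn n m) (leq_maxr _ _).
by exists (maxn n m), (And phi psi) => e /=; rewrite hphi hpsi.
Qed.

Lemma dpred_not (P : env -> Prop) : dpred P -> dpred (fun e => ~ P e).
Proof. by move=> [n [phi h]]; exists n, (Not phi) => e /=; rewrite h. Qed.

Lemma dpred_imply (P Q : env -> Prop) :
  dpred P -> dpred Q -> dpred (fun e => P e -> Q e).
Proof.
move=> hP hQ; apply: dpred_ext (dpred_not (dpred_and hP (dpred_not hQ))) => e.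
split=> [h Pe|h [Pe]]; last by apply; exact: h.
by apply: contrapT => nQ; exact: h.
Qed.

Lemma dpred_or (P Q : env -> Prop) :
  dpred P -> dpred Q -> dpred (fun e => P e \/ Q e).
Proof.
move=> hP hQ; apply: dpred_ext (dpred_imply (dpred_not hP) hQ) => e.
split=> [h|[//|//]]; by have [Pe|/h] := pselect (P e); [left|right].
Qed.

Lemma dpred_ex (P : M -> env -> Prop) :
  dpred (fun e => P (e 0%N) (fun i => e i.+1)) ->
  dpred (fun e => exists x, P x e).
Proof.
move=> [n [phi h]].
have pn (i : 'I_n) : (i.-1 < n)%N := leq_ltn_trans (leq_pred i) (ltn_ord i).
(* Environments bind variable [0] whereas [Ex] binds the last one: [0] is sent to the last place and
   the others move down. The value [i.-1] matters only for positive [i]. *)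
pose s (i : 'I_n) : 'I_(n + 1)%N + M :=
  inl (if i == 0%N :> nat then rshift n ord0 else lshift 1 (Ordinal (pn i))).
exists n, (Ex (fsub phi s)) => e /=.
suff E x : P x e <-> sat (row_mx (\row_(i < n) e i) (const_mx x : 'rV_1)) (fsub phi s).
  by split=> -[x /E]; exists x.
rewrite sat_fsub; set v := \row_i _.
have -> : v = \row_(i < n) (if (i : nat) is k.+1 then e k else x).
  apply/rowP => i; rewrite !mxE /s; case: eqP => [i0|/eqP i0] /=.
    by rewrite row_mxEr mxE i0.
  by rewrite row_mxEl mxE /=; case: (nat_of_ord i) i0.
by rewrite -(h (fun i : nat => if i is k.+1 then e k else x)).
Qed.

Lemma dpred_ex2 (P Q : M -> env -> Prop) :
  dpred (fun e => P (e 0%N) (fun i => e i.+1)) ->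
  dpred (fun e => Q (e 0%N) (fun i => e i.+1)) ->
  dpred (fun e => exists2 x, P x e & Q x e).
Proof.
move=> hP hQ.
apply: dpred_ext (@dpred_ex (fun x e => P x e /\ Q x e) (dpred_and hP hQ)) => e.
by split=> [[x []]|[x]]; exists x.
Qed.

Lemma dpred_all (P : M -> env -> Prop) :
  dpred (fun e => P (e 0%N) (fun i => e i.+1)) ->
  dpred (fun e => forall x, P x e).
Proof.
move=> hP.
apply: dpred_ext (dpred_not (@dpred_ex (fun x e => ~ P x e) (dpred_not hP))) => e.
split=> [h x|h [x]]; last by apply; exact: h.
by apply: contrapT => nP; apply: h; exists x.
Qed.

Lemma dpred_sub (P : env -> Prop) (t : nat -> env -> M) :
  dpred P -> (forall i, dterm (t i)) -> dpred (fun e => P (fun i => t i e)).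
Proof.
move=> [n [phi h]] ht.
have /choice[s hs] i : exists s : nat + M,
    t i = fun e => match s with inl k => e k | inr c => c end.
  by case: (ht i) => [k|c]; [exists (inl k)|exists (inr c)].
(* [b] exceeds all variable indices in the finitely many terms; one more variable makes [inord]
   available even when there are none. *)
pose b := (\max_(i < n) (if s i is inl k then k.+1 else 0))%N.
pose s' (i : 'I_n) : 'I_b.+1 + M :=
  match s i with inl k => inl (inord k) | inr c => inr c end.
exists b.+1, (fsub phi s') => e; rewrite h sat_fsub.
set u := \row_i _; set v := \row_i _; suff -> : u = v by [].
apply/rowP => i; rewrite !mxE hs /s'.
case E: (s i) => [k|c] //=; rewrite mxE inordK //.
have := leq_bigmax (F := fun i : 'I_n => if s i is inl k then k.+1 else 0%N) i.
by rewrite E => /ltnW; rewrite ltnS.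
Qed.

Lemma dpred_set n (A : set 'rV[M]_n) (t : 'I_n -> env -> M) :
  definable S A -> (forall i, dterm (t i)) -> dpred (fun e => A (\row_i t i e)).
Proof.
move=> [phi ->] ht.
have hphi : dpred (fun e => sat (\row_(i < n) e i) phi) by exists n, phi.
pose t' i : env -> M := if insub i is Some k then t k else fun e => e 0%N.
have ht' i : dterm (t' i) by rewrite /t'; case: insub => [k|] ; [exact: ht|exact: dvar].
apply: dpred_ext (dpred_sub hphi ht') => e /=.
set u := \row_i _; set v := \row_i _; suff -> : u = v by [].
by apply/rowP => i; rewrite !mxE /t' valK.
Qed.

Lemma dpred_lt (t u : env -> M) : dterm t -> dterm u -> dpred (fun e => t e < u e).
Proof.
move=> ht hu.
have h : dpred (fun e => e 0%N < e 1%N).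
  exists 2, (Lt (Var S ord0) (Var S ord_max)) => e /=.
  by rewrite !mxE.
pose s i := if i is 0 then t else u.
by apply: (@dpred_sub _ s) h _ => -[|i].
Qed.

Lemma dpred_eq (t u : env -> M) : dterm t -> dterm u -> dpred (fun e => t e = u e).
Proof.
move=> ht hu.
have h : dpred (fun e => e 0%N = e 1%N).
  exists 2, (Eq (Var S ord0) (Var S ord_max)) => e /=.
  by rewrite !mxE.
pose s i := if i is 0 then t else u.
by apply: (@dpred_sub _ s) h _ => -[|i].
Qed.

Lemma dpred_cst (p : Prop) : dpred (fun=> p).
Proof.
have h : dpred (fun e => e 0%N = e 0%N) by apply: dpred_eq; exact: dvar.
have [hp|np] := pselect p; first by apply: dpred_ext h.
by apply: dpred_ext (dpred_not h) => e; split=> // /(_ erefl).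
Qed.

Lemma dpred_forall_fin (T : finType) (P : T -> env -> Prop) :
  (forall i, dpred (P i)) -> dpred (fun e => forall i, P i e).
Proof.
move=> hP.
have h (s : seq T) : dpred (fun e => forall i, i \in s -> P i e).
  elim: s => [|i s IH]; first by apply: dpred_ext (dpred_cst True) => e; split.
  apply: dpred_ext (dpred_and (hP i) IH) => e; split=> [[Pi Ps] k|h].
    by rewrite inE => /predU1P[->//|/Ps].
  by split=> [|k ks]; apply: h; rewrite inE ?eqxx// ks orbT.
apply: dpred_ext (h (enum T)) => e.
by split=> h' i; [apply: h'; rewrite mem_enum|move=> _].
Qed.

Lemma dpred_ex_fun k (P : ('I_k -> M) -> env -> Prop) :
  dpred (fun e => P (fun i => e i) (fun i => e (k + i)%N)) ->
  dpred (fun e => exists f, P f e).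
Proof.
(* The first [n] values come from an infinite [f] instead of a tuple, so the induction on [n] meets
   no dependent types. *)
pose cat n (f e : env) i := if (i < n)%N then f i else e (i - n)%N.
have h n (Q : env -> Prop) : dpred Q -> dpred (fun e => exists f, Q (cat n f e)).
  elim: n Q => [|n IH] Q hQ.
    have E f e : cat 0%N f e = e by apply/funext => i; rewrite /cat subn0.
    apply: dpred_ext hQ => e; split=> [Qe|[f]]; last by rewrite E.
    by exists e; rewrite E.
  pose cons x (e : env) i := if i is k.+1 then e k else x.
  have ce e : cons (e 0%N) (fun i => e i.+1) = e by apply/funext => -[].
  have /(dpred_ex (P := fun x e => exists f, Q (cat n f (cons x e)))) :
      dpred (fun e => exists f, Q (cat n f (cons (e 0%N) (fun i => e i.+1)))).
    by apply: dpred_ext (IH Q hQ) => e; rewrite ce.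
  apply: dpred_ext => e; split=> [[x [f]]|[f Qf]].
    suff -> : cat n f (cons x e) = cat n.+1 (fun i => if i == n then x else f i) e.
      by exists (fun i => if i == n then x else f i).
    apply/funext => i; rewrite /cat ltnS; case: ltngtP => //= [ni|->].
      by rewrite -(subnSK ni).
    by rewrite subnn.
  exists (f n), f; suff <- : cat n.+1 f e = cat n f (cons (f n) e) by [].
  apply/funext => i; rewrite /cat ltnS; case: ltngtP => //= [ni|->].
    by rewrite -(subnSK ni).
  by rewrite subnn.
move=> /(h k); apply: dpred_ext => e.
have E f : (fun i => cat k f e (k + i)%N) = e.
  by apply/funext => i; rewrite /cat ltnNge leq_addr /= addKn.
split=> [[f]|[f Pf]].
  by rewrite E; exists (fun i : 'I_k => cat k f e i).
exists (fun i => if insub i is Some j then f j else e 0%N); rewrite E.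
set g := (X in P X _); suff -> : g = f by [].
by apply/funext => i; rewrite /g /cat ltn_ord valK.
Qed.

Definition extend n (c : M) (v : 'rV[M]_n) : env :=
  fun i => if insub i is Some k then v ord0 k else c.

Lemma extendE n c (v : 'rV[M]_n) (i : 'I_n) : extend c v i = v ord0 i.
Proof. by rewrite /extend valK. Qed.

Lemma definable_dpred n c (P : env -> Prop) :
  dpred P -> definable S [set v : 'rV[M]_n | P (extend c v)].
Proof.
move=> [m [phi h]].
exists (fsub phi (fun i => if insub (val i) is Some k then inl k else inr c)).
apply/seteqP; split=> v /=; rewrite sat_fsub h;
  set u := \row_i _; set w := \row_i _; suff -> : u = w => //;
  by apply/rowP => i; rewrite !mxE /extend; case: insub.
Qed.

Lemma definable_dpred1 (c : M) (A : set M) :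
  dpred (fun e => A (e 0%N)) -> definable S [set (const_mx x : 'rV_1) | x in A].
Proof.
move=> dA; have := definable_dpred 1 c dA.
set B := [set _ | _]; set C := [set _ | _ in _]; suff -> : B = C by [].
apply/seteqP; split=> [v Av|_ [x Ax <-]].
  exists (v ord0 ord0); first by rewrite -(extendE c).
  by apply/rowP => i; rewrite mxE (ord1 i) (ord1 ord0).
suff : A (extend c (const_mx x : 'rV_1) (@ord0 0)) by [].
by rewrite extendE mxE.
Qed.

End DefinablePredicates.

#[local] Hint Resolve dvar dcst : core.

(** * Ends of intervals and tame sets *)

Lemma neq_negb (b c : bool) : b != c -> b = ~~ c.
Proof. by case: b c => -[]. Qed.

Section OrientedOrder.
Context {d : Order.disp_t} {M : orderType d}.
Implicit Types (s : bool) (x y z w t : M) (E : itv_bound M).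

(** The Boolean reverses the order, so that one proof covers left and right, increasing and
    decreasing. *)
Definition olt s x y : bool := if s then y < x else x < y.
Definition ole s x y : bool := if s then y <= x else x <= y.

Lemma oltxx s x : olt s x x = false.
Proof. by case: s; exact: ltxx. Qed.

Lemma olexx s x : ole s x x.
Proof. by case: s; exact: lexx. Qed.

Lemma olt_trans s y x z : olt s x y -> olt s y z -> olt s x z.
Proof. by case: s => [h1 h2|]; [exact: lt_trans h2 h1|exact: lt_trans]. Qed.

Lemma ole_lt_trans s y x z : ole s x y -> olt s y z -> olt s x z.
Proof. by case: s => [h1 h2|]; [exact: lt_le_trans h2 h1|exact: le_lt_trans]. Qed.

Lemma olt_le_trans s y x z : olt s x y -> ole s y z -> olt s x z.
Proof. by case: s => [h1 h2|]; [exact: le_lt_trans h2 h1|exact: lt_le_trans]. Qed.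

Lemma ole_trans s y x z : ole s x y -> ole s y z -> ole s x z.
Proof. by case: s => [h1 h2|]; [exact: le_trans h2 h1|exact: le_trans]. Qed.

Lemma oltW s x y : olt s x y -> ole s x y.
Proof. by case: s; exact: ltW. Qed.

Lemma oltNge s x y : olt s x y = ~~ ole s y x.
Proof. by case: s; exact: ltNge. Qed.

Lemma oleNgt s x y : ole s x y = ~~ olt s y x.
Proof. by case: s; exact: leNgt. Qed.

Lemma oltN s x y : olt (~~ s) x y = olt s y x.
Proof. by case: s. Qed.

Lemma oleN s x y : ole (~~ s) x y = ole s y x.
Proof. by case: s. Qed.

Lemma olt_total s x y : [\/ olt s x y, x = y | olt s y x].
Proof.
by case: s; case: (ltgtP x y) => h; [apply: Or33|apply: Or31|apply: Or32|
  apply: Or31|apply: Or33|apply: Or32].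
Qed.

Lemma olt_asym s x y : olt s x y -> olt s y x -> False.
Proof. by move=> h1 h2; have := olt_trans h1 h2; rewrite oltxx. Qed.

(* A bound [BSide s a] stands for the end [a^-] (if [s]) or [a^+], and [BInfty s]
   for the end [-oo] (if [s]) or [+oo]; [olt (end_dir E)] is the order, reversed
   if necessary, in which [E] is approached downwards.                        *)
Definition end_dir E : bool := match E with BSide s _ => s | BInfty s => ~~ s end.

Definition beyond E t : bool := if E is BSide s a then olt s a t else true.

Definition past E w t : bool := beyond E t && olt (end_dir E) t w.

Definition near_end E : set_system M :=
  [set Q | exists2 w, beyond E w & forall t, past E w t -> Q t].

Lemma near_past E w : beyond E w -> near_end E (past E w).
Proof. by move=> Ew; exists w. Qed.

Definition near_side s x : set_system M := near_end (BSide s x).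

Lemma near_sideP s x (Q : set M) :
  near_side s x Q <-> exists2 w, olt s x w & forall t, olt s x t -> olt s t w -> Q t.
Proof.
split=> -[w xw h]; exists w => // t; last by move=> /andP[]; exact: h.
by move=> xt tw; apply: h; rewrite /past /= xt.
Qed.

End OrientedOrder.

Section Tame.
Context {d : Order.disp_t} {M : orderType d} (S : structure M).
Hypothesis oM : o_minimal S.
Implicit Types (s : bool) (x y z w t : M) (E : itv_bound M) (A : set M).

Lemma olt_dense s x y : olt s x y -> exists2 z, olt s x z & olt s z y.
Proof. by case: s => /(omin_dense oM)[z /andP[? ?]]; exists z. Qed.

Lemma olt_unbounded s x : exists y, olt s x y.
Proof. by case: s; [exact: (omin_nomin oM)|exact: (omin_nomax oM)]. Qed.

Lemma beyond_ex E : exists w, beyond E w.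
Proof.
case: E => [s a|s]; first exact: olt_unbounded.
by have [x _] := omin_inhabited oM; exists x.
Qed.

Lemma past_ex E w : beyond E w -> exists t, past E w t.
Proof.
case: E => [s a /olt_dense[t ? ?]|s _]; first by exists t; apply/andP.
by have [y] := olt_unbounded s w; exists y; rewrite /past /= oltN.
Qed.

Lemma past_trans E w w' t : ole (end_dir E) w w' -> past E w t -> past E w' t.
Proof. by move=> ww' /andP[Et tw]; rewrite /past Et /=; exact: olt_le_trans ww'. Qed.

Lemma near_end_filter E : ProperFilter (near_end E).
Proof.
apply: Build_ProperFilter.
  by move=> [w /past_ex[t wt] /(_ _ wt)].
split; first by have [w Ew] := beyond_ex E; exists w.
  move=> P Q [w Ew wP] [w' Ew' wQ].
  have [ww'|] := boolP (ole (end_dir E) w w').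
    by exists w => // t wt; split; [exact: wP|exact: wQ (past_trans ww' wt)].
  rewrite -oltNge => /oltW w'w; exists w' => // t wt.
  by split; [exact: wP (past_trans w'w wt)|exact: wQ].
by move=> P Q PQ [w Ew wP]; exists w => // t /wP /PQ.
Qed.

#[local] Existing Instance near_end_filter.

Definition near_side_filter s x : ProperFilter (near_side s x) := near_end_filter _.

#[local] Existing Instance near_side_filter.

Lemma near_beyond E : near_end E (beyond E).
Proof. by have [w Ew] := beyond_ex E; exists w => // t /andP[]. Qed.

Lemma near_olt E s c : near_end E (olt s ^~ c) \/ near_end E (olt s c).
Proof.
suff [h|h] : near_end E (olt (end_dir E) ^~ c) \/ near_end E (olt (end_dir E) c).
- have [<-|/neq_negb Es] := eqVneq (end_dir E) s; [by left|right].
  by apply: filterS h => t; rewrite Es oltN.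
- have [<-|/neq_negb Es] := eqVneq (end_dir E) s; [by right|left].
  by apply: filterS h => t; rewrite Es oltN.
case: E => [r a|r] /=; last by left; exists c => // t /andP[].
have [ac|] := boolP (olt r a c); first by left; exists c => // t /andP[].
rewrite -oleNgt => ca; right; have [w aw] := olt_unbounded r a.
by exists w => // t /andP[at_ _]; exact: ole_lt_trans at_.
Qed.

(** The form in which o-minimality is mostly used: no oscillation at an end, be it one side of a
    point or an infinity. *)
Definition tame A := forall E, near_end E A \/ near_end E (~` A).

Lemma tameC A : tame A -> tame (~` A).
Proof. by move=> tA E; rewrite setCK; case: (tA E); [right|left]. Qed.

Lemma tameU A B : tame A -> tame B -> tame (A `|` B).
Proof.
move=> tA tB E; case: (tA E) => [h|hA]; first by left; apply: filterS h => t; left.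
case: (tB E) => [h|hB]; first by left; apply: filterS h => t; right.
by right; rewrite setCU; exact: filterI.
Qed.

Lemma tame_olt s c : tame (olt s c).
Proof.
move=> E; case: (near_olt E s c) => h; last by left.
by right; apply: filterS h => t tc /(olt_asym tc).
Qed.

Lemma tame1 c : tame [set c].
Proof.
have -> : [set c] = ~` (olt true c `|` olt false c).
  apply/seteqP; split=> [_ ->[]|t h]; rewrite ?oltxx//.
  by case: (olt_total true c t) => // h'; exfalso; apply: h; [left|right].
by apply: tameC; apply: tameU; exact: tame_olt.
Qed.

Lemma tameI A B : tame A -> tame B -> tame (A `&` B).
Proof.
move=> tA tB; rewrite -[A]setCK -[B]setCK -setCU.
by apply/tameC/tameU; exact: tameC.
Qed.

Lemma tame_beyond E : tame (beyond E).
Proof.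
case: E => [s a|s]; first exact: tame_olt.
by move=> E; left; apply: filterS filterT.
Qed.

Lemma open_ends_dir (lo hi : itv_bound M) : itv_open_ends (Interval lo hi) ->
  end_dir lo = false /\ end_dir hi = true.
Proof. by case: lo hi => [[] a|[]] [[] b|[]]. Qed.

Lemma mem_open_itv (lo hi : itv_bound M) t : itv_open_ends (Interval lo hi) ->
  (t \in Interval lo hi) = beyond lo t && beyond hi t.
Proof. by case: lo hi => [[] a|[]] [[] b|[]]; rewrite // in_itv. Qed.

(** O-minimality as induction over finite unions. An interval appears as a pair of ends of opposite
    directions, which suits both orientations of the order. *)
Lemma omin_ind (P : set M -> Prop) :
  P set0 -> (forall x, P [set x]) ->
  (forall E E', end_dir E' = ~~ end_dir E -> P (fun t => beyond E t && beyond E' t)) ->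
  (forall A B, P A -> P B -> P (A `|` B)) ->
  forall A, dpred S (fun e => A (e 0%N)) -> P A.
Proof.
move=> P0 P1 PE PU A dA.
have [c _] := omin_inhabited oM.
have [s [t [ot ->]]] := omin_definable oM (definable_dpred1 c dA).
have scons (T : eqType) (x : T) r : [set` x :: r] = [set x] `|` [set` r].
  apply/seteqP; split=> y /=; rewrite inE; first by move=> /predU1P.
  by move=> h; apply/predU1P.
apply: (PU).
  elim: s => [|x s IH]; first by rewrite classical_sets.set_nil.
  by rewrite scons; exact: PU.
elim: t ot => [|[lo hi] t IH] ot; first by rewrite classical_sets.set_nil bigcup_set0.
rewrite scons bigcup_setU bigcup_set1; apply: (PU); last first.
  by apply: IH => i it; apply: ot; rewrite inE it orbT.
have io := ot _ (mem_head _ _); have [lod hid] := open_ends_dir io.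
have -> : [set` Interval lo hi] = (fun t => beyond lo t && beyond hi t).
  by apply/funext => x; rewrite /= mem_open_itv.
by apply: PE; rewrite lod hid.
Qed.

Lemma dpred_tame A : dpred S (fun e => A (e 0%N)) -> tame A.
Proof.
apply: omin_ind.
- by move=> E; right; rewrite setC0; exact: filterT.
- exact: tame1.
- move=> E E' _.
  suff -> : (fun t => beyond E t && beyond E' t : Prop) =
      [set t | beyond E t] `&` [set t | beyond E' t] by apply: tameI; exact: tame_beyond.
  by apply/funext => t; apply/propext; split=> /andP.
- exact: tameU.
Qed.

(** The order need not be complete, but a finite union of points and intervals is empty, unbounded
    or has a supremum, and this trichotomy passes to unions. Taking [s = true] gives infima. *)
Lemma sup_ex s A : dpred S (fun e => A (e 0%N)) -> A !=set0 ->
  (exists u, forall x, A x -> ole s x u) ->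
  exists2 p, (forall x, A x -> ole s x p) &
    forall q, olt s q p -> exists2 x, A x & olt s q x.
Proof.
move: A.
pose lub A p := (forall x, A x -> ole s x p) /\
    forall q, olt s q p -> exists2 x, A x & olt s q x.
pose P A := [\/ A = set0, forall u, exists2 x, A x & olt s u x | exists p, lub A p].
suff PA : forall A, dpred S (fun e => A (e 0%N)) -> P A.
  move=> A /PA[->[x []]|h _ [u hu]|[p [h1 h2]] _ _]; last by exists p.
  by have [x /hu] := h u; rewrite oleNgt => /negP.
apply: omin_ind.
- exact: Or31.
- move=> x; apply: Or33; exists x; split=> [_ ->|q qx]; first exact: olexx.
  by exists x.
- suff PE E E' : end_dir E = ~~ s -> end_dir E' = s ->
      P (fun t => beyond E t && beyond E' t).
    move=> E E'; have [Es|Es] := eqVneq (end_dir E) s => EE'; last first.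
      by apply: PE; rewrite ?EE' (neq_negb Es) ?negbK.
    suff -> : (fun t => beyond E t && beyond E' t : Prop) =
        (fun t => beyond E' t && beyond E t) by apply: PE; rewrite ?EE' Es.
    by apply/funext => t; rewrite andbC.
  move=> Es E's.
  have [[x /andP[Ex E'x]]|n0] := pselect (exists x, beyond E x && beyond E' x);
    last first.
    apply: Or31; apply/seteqP; split=> // t Et; exfalso; apply: n0; by exists t.
  have E'up t : ole s x t -> beyond E' t.
    case: E' E's E'x => [r a /= ->|//]; exact: olt_le_trans.
  (* The larger of [q] and the interval point [x]: from there on, the bound [E'] holds
     automatically. *)
  have join q : exists2 m, ole s q m & ole s x m /\ (m = q \/ m = x).
    have [qx|] := boolP (ole s q x); first by exists x => //; split; [exact: olexx|right].
    by rewrite -oltNge => /oltW xq; exists q; [exact: olexx|split=> //; left].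
  case: E Es Ex => [r b|r] /= => [->|/(congr1 negb)]; rewrite ?oltN ?negbK.
    move=> xb; apply: Or33; exists b; split=> [t /andP[]|q qb].
      by rewrite oltN => /oltW.
    have [m qm [xm mE]] := join q.
    have /olt_dense[z mz zb] : olt s m b by case: mE => ->.
    exists z; last exact: ole_lt_trans mz.
    by rewrite oltN zb E'up//; apply: ole_trans xm (oltW mz).
  move=> rs _; apply: Or32 => u; have [m um [xm _]] := join u.
  have [z mz] := olt_unbounded s m.
  by exists z; [rewrite E'up//; apply: ole_trans xm (oltW mz)|exact: ole_lt_trans mz].
- move=> A B [->|hA|[p [p1 p2]]]; first by rewrite set0U.
    by move=> _; apply: Or32 => u; have [x ? ?] := hA u; exists x => //; left.
  move=> [->|hB|[q [q1 q2]]].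
  + by rewrite setU0; apply: Or33; exists p.
  + by apply: Or32 => u; have [x ? ?] := hB u; exists x => //; right.
  + apply: Or33; have [pq|] := boolP (ole s p q).
      exists q; split=> [x [/p1 xp|/q1//]|r /q2[x Bx rx]].
        exact: ole_trans pq.
      by exists x => //; right.
    rewrite -oltNge => /oltW qp; exists p; split=> [x [/p1//|/q1 xq]|r /p2[x Ax rx]].
      exact: ole_trans qp.
    by exists x => //; left.
Qed.

End Tame.

(** * Continuity of definable functions *)

Section DefinableNear.
Context {d : Order.disp_t} {M : orderType d} (S : structure M).

Lemma dterm_tail (t : (nat -> M) -> M) : dterm t -> dterm (fun e => t (fun i => e i.+1)).
Proof. by case. Qed.

Lemma dpred_olt s (t u : (nat -> M) -> M) :
  dterm t -> dterm u -> dpred S (fun e => olt s (t e) (u e)).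
Proof. by case: s => ht hu; exact: dpred_lt. Qed.

Lemma dpred_beyond E (t : (nat -> M) -> M) :
  dterm t -> dpred S (fun e => beyond E (t e)).
Proof.
by case: E => [s a|s] ht; [exact: dpred_olt|apply: dpred_ext (dpred_cst S True)].
Qed.

Lemma dpred_past E (t u : (nat -> M) -> M) :
  dterm t -> dterm u -> dpred S (fun e => past E (t e) (u e)).
Proof.
move=> ht hu; apply: dpred_ext (dpred_and (dpred_beyond E hu)
  (@dpred_olt (end_dir E) _ _ hu ht)) => e.
by split=> /andP.
Qed.

Lemma dpred_near_end E (P : M -> (nat -> M) -> Prop) :
  dpred S (fun e => P (e 0%N) (fun i => e i.+1)) ->
  dpred S (fun e => near_end E (fun t => P t e)).
Proof.
move=> hP; apply: dpred_ex2; first exact: dpred_beyond.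
apply: dpred_all; apply: dpred_imply; first exact: dpred_past.
by apply: (@dpred_sub _ _ S _ (fun i e => if i is k.+1 then e k.+2 else e 0%N)) hP _
  => -[|i].
Qed.

Lemma dpred_near_side s (t : (nat -> M) -> M) (P : M -> (nat -> M) -> Prop) :
  dterm t -> dpred S (fun e => P (e 0%N) (fun i => e i.+1)) ->
  dpred S (fun e => near_side s (t e) (fun x => P x e)).
Proof.
move=> ht hP.
apply: (@dpred_ext _ _ _ (fun e => exists2 w, olt s (t e) w &
    forall x, olt s (t e) x -> olt s x w -> P x e)).
  by move=> e; rewrite near_sideP.
apply: dpred_ex2; first exact: dpred_olt (dterm_tail ht) _.
apply: dpred_all; apply: dpred_imply; first exact: dpred_olt (dterm_tail (dterm_tail ht)) _.
apply: dpred_imply; first exact: dpred_olt.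
by apply: (@dpred_sub _ _ S _ (fun i e => if i is k.+1 then e k.+2 else e 0%N)) hP _
  => -[|i].
Qed.

End DefinableNear.

Section Continuity.
Context {d : Order.disp_t} {M : orderType d} (S : structure M).
Hypothesis oM : o_minimal S.
Variable f : M -> M.
Hypothesis df : dpred S (fun e => e 0%N = f (e 1%N)).
Implicit Types (s r : bool) (x y z w t : M) (E : itv_bound M).

Let end_filter E : ProperFilter (near_end E) := near_end_filter oM E.
Let side_filter s x : ProperFilter (near_side s x) := near_side_filter oM s x.
#[local] Existing Instance end_filter.
#[local] Existing Instance side_filter.

Lemma dpred_app (t : (nat -> M) -> M) (Q : M -> (nat -> M) -> Prop) :
  dterm t -> dpred S (fun e => Q (e 0%N) (fun i => e i.+1)) ->
  dpred S (fun e => Q (f (t e)) e).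
Proof.
move=> ht hQ.
apply: (@dpred_ext _ _ _ (fun e => exists2 x, x = f (t e) & Q x e)).
  by move=> e; split=> [[x -> //]|h]; exists (f (t e)).
apply: dpred_ex2 hQ.
apply: (@dpred_sub _ _ S _ (fun i e => if i is 0 then e 0%N else t (fun i => e i.+1))) df _.
by move=> [|i] //; exact: dterm_tail.
Qed.

Lemma dpred_olt_app s (t u : (nat -> M) -> M) : dterm t -> dterm u ->
  dpred S (fun e => olt s (f (t e)) (u e)).
Proof.
move=> ht hu; apply: (@dpred_app t (fun x e => olt s x (u e))) => //.
exact: dpred_olt _ (dterm_tail hu).
Qed.

Lemma dpred_olt_app2 s (t u : (nat -> M) -> M) : dterm t -> dterm u ->
  dpred S (fun e => olt s (f (t e)) (f (u e))).
Proof.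
move=> ht hu; apply: (@dpred_app t (fun x e => olt s x (f (u e)))) => //.
apply: (@dpred_app _ (fun x e => olt s (e 0%N) x)); first exact: dterm_tail.
exact: dpred_olt.
Qed.

Lemma near_trichotomy E r c :
  [\/ near_end E (fun t => olt r (f t) c), near_end E (fun t => f t = c)
    | near_end E (fun t => olt r c (f t))].
Proof.
have h r' : tame (fun t => olt r' (f t) c).
  by apply: (dpred_tame oM); apply: dpred_olt_app.
case: (h r E) => h1; first exact: Or31.
case: (h (~~ r) E) => h2; first by apply: Or33; apply: filterS h2 => t; rewrite oltN.
apply: Or32; apply: filterS2 h1 h2 => t /= n1 n2.
by case: (olt_total r (f t) c) => // ftc; exfalso; apply: n2; rewrite oltN.
Qed.

Lemma near_side_olt s x w : olt s x w -> near_side s x (olt s ^~ w).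
Proof. by move=> xw; apply/near_sideP; exists w. Qed.

Lemma near_sideN_olt s x w : olt s w x -> near_side (~~ s) x (olt s w).
Proof.
by rewrite -oltN => /near_side_olt; apply: filterS => t; rewrite oltN.
Qed.

(** Strict on both sides; for [r = true] this is a strict local maximum. *)
Definition local_min r x := forall s, near_side s x (fun t => olt r (f x) (f t)).

(** Crossing [y] in the direction [s], the function falls, for the order [r], through a level
    [z]. *)
Definition jump s r y := exists z,
  near_side (~~ s) y (fun t => olt r z (f t)) /\ near_side s y (fun t => olt r (f t) z).

Lemma local_min_not_const s r x :
  local_min r x -> near_side s x (fun t => f t = f x) -> False.
Proof.
move=> /(_ s) h1 h2; have [t [/= + ft]] := filter_ex (filterI h1 h2).
by rewrite ft oltxx.
Qed.

(** If [B] held near [b], then [f] would increase there, against local minimality; so it fails near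
    [b]. Fix [x] there. Were the values finally above [f x], the supremum of the points where they
    are not would satisfy [B]. Constancy is excluded too, so the values end below [f x], and the
    infimum of the points from which they stay below is a jump through [f x]. *)
Lemma jump_ex s r a b : olt s a b ->
  (forall x, olt s a x -> olt s x b -> local_min r x) ->
  exists y, [/\ olt s a y, olt s y b & jump s r y].
Proof.
move=> ab lm; pose E := BSide (~~ s) b.
pose B x := forall y, olt s x y -> olt s y b -> olt r (f x) (f y).
have inE : near_end E (fun t => olt s a t /\ olt s t b).
  by exists a => [|t /andP[]]; rewrite /= !oltN.
have dB : dpred S (fun e => B (e 0%N)).
  apply: dpred_all; apply: dpred_imply; first exact: dpred_olt.
  by apply: dpred_imply; [exact: dpred_olt|exact: dpred_olt_app2].
have pastE w t : olt s w t -> olt s t b -> past E w t.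
  by move=> wt tb; rewrite /past /= !oltN tb.
have pastE_lt w t : past E w t -> olt s w t /\ olt s t b.
  by rewrite /past /= !oltN => /andP[].
case: (dpred_tame oM dB E) => [nB|nB].
  have [w Ew wB] : near_end E (fun t => B t /\ olt s a t).
    by apply: filterI nB _; apply: filterS inE => t [].
  have [y /[dup] /pastE_lt[wy yb] /wB[_ ay]] := past_ex oM Ew.
  have h1 := lm y ay yb (~~ s); have h2 := near_sideN_olt wy.
  have h3 := near_beyond oM (BSide (~~ s) y).
  have [t [yt [wt]]] := filter_ex (filterI h1 (filterI h2 h3)).
  rewrite /= oltN => ty; have [Bt _] := wB t (pastE _ _ wt (olt_trans ty yb)).
  by case: (olt_asym yt (Bt y ty yb)).
have [w Ew wB] := filterI nB inE.
have [x /[dup] /pastE_lt[wx xb] /wB[_ [ax _]]] := past_ex oM Ew.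
(* A function constant just before [c] has inner points there that are not strict local minima. *)
have noconst c : near_side (~~ s) c (fun t => olt s a t /\ olt s t b) ->
    near_side (~~ s) c (fun t => f t = f x) -> False.
  move=> h1 h2; have [w1 cw1 h] := filterI h1 h2.
  have [y yp] := past_ex oM cw1; have [[ay yb] fy] := h y yp.
  move: yp; rewrite /past /= !oltN => /andP[yc w1y].
  apply: (local_min_not_const (lm y ay yb) (s := s)).
  apply: filterS2 (near_beyond oM (BSide s y)) (near_side_olt yc) => t /= yt tc.
  by rewrite fy; apply: (h t _).2; rewrite /past /= !oltN tc (olt_trans w1y).
case: (near_trichotomy E r (f x)) => hx.
- pose C y := [/\ olt s x y, olt s y b &
    forall t, olt s y t -> olt s t b -> olt r (f t) (f x)].
  have dC : dpred S (fun e => C (e 0%N)).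
    apply: (@dpred_ext _ _ _ (fun e => olt s x (e 0%N) /\ (olt s (e 0%N) b /\
      forall t, olt s (e 0%N) t -> olt s t b -> olt r (f t) (f x)))).
      by move=> e; split=> [[? []]|[]].
    apply: dpred_and; first exact: dpred_olt.
    apply: dpred_and; first exact: dpred_olt.
    apply: dpred_all; apply: dpred_imply; first exact: dpred_olt.
    by apply: dpred_imply; [exact: dpred_olt|exact: dpred_olt_app].
  have C0 : C !=set0.
    have [w' Ew' hw'] : near_end E (fun t => olt r (f t) (f x) /\ olt s x t).
      apply: filterI hx _; by apply: near_sideN_olt.
    have [y yp] := past_ex oM Ew'; have [w'y yb] := pastE_lt _ _ yp.
    have [_ xy] := hw' y yp; exists y; split=> // t yt tb.
    by have [] := hw' t (pastE _ _ (olt_trans w'y yt) tb).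
  have [q Cq qC] : exists2 q, (forall y, C y -> ole s q y) &
      forall u, olt s q u -> exists2 y, C y & olt s y u.
    have [|q h1 h2] := @sup_ex _ _ _ oM (~~ s) C dC C0.
      by exists x => y [xy _ _]; rewrite oleN; exact: oltW.
    exists q => [y /h1|u]; first by rewrite oleN.
    by rewrite -oltN => /h2[y Cy]; rewrite oltN; exists y.
  have xq : olt s x q.
    have /near_sideP[w' xw' h] := lm x ax xb s.
    apply: olt_le_trans xw' _; rewrite oleNgt; apply/negP => qw'.
    have [c [xc cb Cc] cw'] := qC _ qw'.
    have [t [ct [tw' tb]]] := filter_ex (filterI (near_beyond oM (BSide s c))
      (filterI (near_side_olt cw') (near_side_olt cb))).
    exact: olt_asym (Cc t ct tb) (h t (olt_trans xc ct) tw').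
  have qb : olt s q b by have [c Cc] := C0; case: (Cc) => _ cb _; exact: ole_lt_trans (Cq _ Cc) cb.
  have fq t : olt s q t -> olt s t b -> olt r (f t) (f x).
    by move=> /qC[c [_ _ Cc] ct]; exact: Cc.
  have inq : near_side (~~ s) q (fun t => olt s a t /\ olt s t b).
    apply: filterS2 (near_beyond oM (BSide (~~ s) q)) (near_sideN_olt (olt_trans ax xq)).
    by move=> t /=; rewrite oltN => tq at_; split=> //; exact: olt_trans qb.
  case: (near_trichotomy (BSide (~~ s) q) r (f x)) => hq.
  (* With values below [f x] just before [q], and then at [q] by local minimality, [C] would contain
     points before [q]. *)
  + have lq := lm q (olt_trans ax xq) qb (~~ s).
    have [t [/= ft fqt]] := filter_ex (filterI hq lq).
    have fqx := olt_trans fqt ft.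
    have [w1 qw1 h1] := filterI hq (near_sideN_olt xq).
    have [t0 t0p] := past_ex oM qw1; have [_ xt0] := h1 _ t0p.
    move: t0p; rewrite /past /= !oltN => /andP[t0q w1t0].
    have : C t0.
      split=> // [|u t0u ub]; first exact: olt_trans qb.
      have [uq|-> //|qu] := olt_total s u q; last exact: fq.
      by apply: (h1 u _).1; rewrite /past /= !oltN uq (olt_trans w1t0).
    by move=> /Cq; rewrite oleNgt t0q.
  + by have := noconst _ inq hq.
  + exists q; split=> //; first exact: olt_trans xq.
    exists (f x); split=> //.
    by apply: filterS2 (near_beyond oM (BSide s q)) (near_side_olt qb) => t; exact: fq.
- by have := noconst _ inE hx.
- pose D y := [/\ olt s x y, olt s y b & ~ olt r (f x) (f y)].
  have dD : dpred S (fun e => D (e 0%N)).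
    apply: (@dpred_ext _ _ _ (fun e => olt s x (e 0%N) /\ (olt s (e 0%N) b /\
      ~ olt r (f x) (f (e 0%N))))).
      by move=> e; split=> [[? []]|[]].
    apply: dpred_and; first exact: dpred_olt.
    apply: dpred_and; first exact: dpred_olt.
    apply: dpred_not; apply: dpred_ext (dpred_olt_app (~~ r) (dvar 0) (dcst (f x))) => e.
    by rewrite oltN.
  have D0 : D !=set0.
    apply: contrapT => nD; apply: (wB x _).1; first exact: pastE.
    move=> y xy yb; apply: contrapT => n; apply: nD; by exists y.
  have [p Dp pD] := sup_ex oM dD D0 (ex_intro _ b (fun y '(And3 _ yb _) => oltW yb)).
  have xp : olt s x p by have [y Dy] := D0; case: (Dy) => xy _ _; exact: olt_le_trans (Dp _ Dy).
  have pb : olt s p b.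
    have [w1 /= bw1 h1] := hx; rewrite oltN in bw1.
    apply: ole_lt_trans bw1; rewrite oleNgt; apply/negP => /pD[y [_ yb ny] w1y].
    by apply: ny; apply: h1; exact: pastE.
  (* Otherwise [p] is not in [D], so [D] accumulates at [p], whereas local minimality keeps the
     values above [f x] just before [p]. *)
  have fp : ~ olt r (f x) (f p).
    move=> fxp; have [w2 /= pw2 h2] := lm p (olt_trans ax xp) pb (~~ s).
    rewrite oltN in pw2; have [y Dy w2y] := pD _ pw2; have [_ _ ny] := Dy.
    have [yp|yp|py] := olt_total s y p.
    - by apply/ny/(olt_trans fxp)/h2; rewrite /past /= !oltN yp.
    - by apply: ny; rewrite yp.
    - by have := Dp _ Dy; rewrite oleNgt py.
  have [nBp _] := wB p (pastE _ _ (olt_trans wx xp) pb).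
  exfalso; apply: nBp => y py yb.
  have fxy : olt r (f x) (f y).
    apply: contrapT => n; have /Dp : D y by split=> //; exact: olt_trans py.
    by rewrite oleNgt py.
  by apply: ole_lt_trans fxy; rewrite oleNgt; apply/negP.
Qed.

(** Half-lines and one-sided neighbourhoods make continuity a first-order condition on [x], hence a
    definable one. *)
Definition continuous_at x :=
  forall r u, olt r u (f x) -> forall s, near_side s x (fun t => olt r u (f t)).

Lemma dpred_near_olt s r :
  dpred S (fun e => near_side s (e 0%N) (fun t => olt r (f (e 0%N)) (f t))).
Proof.
apply: (@dpred_near_side _ _ _ _ _ (fun t e => olt r (f (e 0%N)) (f t))) => //.
exact: dpred_olt_app2.
Qed.

(* If every point were a local minimum, then by [jump_ex] applied in both directions
   some point would be a jump upwards and downwards at once.                  *)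
Lemma local_min_not_interval s r a b : olt s a b ->
  (forall x, olt s a x -> olt s x b -> local_min r x) -> False.
Proof.
move=> ab lm.
have dJ : dpred S (fun e => jump s r (e 0%N)).
  apply: dpred_ex; apply: dpred_and.
    apply: (@dpred_near_side _ _ _ _ _ (fun t e => olt r (e 0%N) (f t))) => //.
    apply: dpred_ext (dpred_olt_app (~~ r) (dvar 0) (dvar 1)) => e.
    by rewrite oltN.
  apply: (@dpred_near_side _ _ _ _ _ (fun t e => olt r (f t) (e 0%N))) => //.
  exact: dpred_olt_app.
case: (dpred_tame oM dJ (BSide (~~ s) b)) => hJ; last first.
  have [w bw h] := filterI hJ (near_sideN_olt ab); have [w' wp] := past_ex oM bw.
  have [_ aw'] := h _ wp; move: wp; rewrite /past /= !oltN => /andP[w'b ww'].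
  have [x w'x xb|y [wy yb Jy]] := jump_ex (r := r) w'b.
    by apply: lm => //; exact: olt_trans w'x.
  have yp : past (BSide (~~ s) b) w y by rewrite /past /= !oltN yb (olt_trans ww').
  by have [] := h y yp.
have [w /= bw h] := filterI hJ (near_sideN_olt ab); rewrite oltN in bw.
have bw' : olt (~~ s) b w by rewrite oltN.
have wP t : olt s w t -> olt s t b -> past (BSide (~~ s) b) w t.
  by move=> wt tb; rewrite /past /= !oltN tb.
have [|y [by_ yw [z' [h1 h2]]]] := jump_ex (r := r) bw'.
  move=> x; rewrite !oltN => xb wx; apply: lm => //.
  exact: (h x (wP _ wx xb)).2.
rewrite !oltN in by_ yw; rewrite negbK in h1.
have [z [h3 h4]] := (h y (wP _ yw by_)).1.
have [t [/= t1 t2]] := filter_ex (filterI h1 h4).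
have [u [/= u1 u2]] := filter_ex (filterI h2 h3).
exact: olt_asym (olt_trans t1 t2) (olt_trans u2 u1).
Qed.

(** Let [q] be the infimum of the violations after [x]. The increase just before [q] gives the
    inequality at [q], and the increase just after extends it further, so violations cannot
    accumulate at [q]. *)
Lemma local_mono s r a b :
  (forall x, olt s a x -> olt s x b ->
    near_side (~~ s) x (fun t => olt r (f t) (f x)) /\
    near_side s x (fun t => olt r (f x) (f t))) ->
  forall x y, olt s a x -> olt s x y -> olt s y b -> olt r (f x) (f y).
Proof.
move=> inc x y ax xy yb; apply: contrapT => nxy.
pose D t := [/\ olt s x t, olt s t b & ~ olt r (f x) (f t)].
have dD : dpred S (fun e => D (e 0%N)).
  apply: (@dpred_ext _ _ _ (fun e => olt s x (e 0%N) /\ (olt s (e 0%N) b /\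
    ~ olt r (f x) (f (e 0%N))))).
    by move=> e; split=> [[? []]|[]].
  apply: dpred_and; first exact: dpred_olt.
  apply: dpred_and; first exact: dpred_olt.
  apply: dpred_not; apply: dpred_ext (dpred_olt_app (~~ r) (dvar 0) (dcst (f x))) => e.
  by rewrite oltN.
have [||q qD Dq] := @sup_ex _ _ _ oM (~~ s) D dD.
- by exists y.
- by exists x => t [xt _ _]; rewrite oleN; exact: oltW.
have {}qD t : D t -> ole s q t by move=> /qD; rewrite oleN.
have {}Dq t : olt s q t -> exists2 u, D u & olt s u t.
  by rewrite -oltN => /Dq[u Du]; rewrite oltN; exists u.
have qy : ole s q y by apply: qD.
have qb := ole_lt_trans qy yb.
have xq : olt s x q.
  have [_ /near_sideP[w xw h]] := inc x ax (olt_trans xy yb).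
  apply: olt_le_trans xw _; rewrite oleNgt; apply/negP => qw.
  by have [u [xu _ nu] uw] := Dq _ qw; apply: nu; exact: h.
have [h1 /near_sideP[w qw h2]] := inc q (olt_trans ax xq) qb.
have [t [/= tq [xt +]]] := filter_ex (filterI h1 (filterI (near_sideN_olt xq)
  (near_beyond oM (BSide (~~ s) q)))).
rewrite /= oltN => t_q.
have fxq : olt r (f x) (f q).
  apply: olt_trans tq; apply: contrapT => nt.
  have /qD : D t by split=> //; exact: olt_trans qb.
  by rewrite oleNgt t_q.
have [u Du uw] := Dq _ qw; have [xu ub nu] := Du; apply: nu.
have [qu|<- //|uq] := olt_total s q u; last by have := qD _ Du; rewrite oleNgt uq.
exact: olt_trans (h2 _ qu uw).
Qed.

Lemma near_side_gt s s' x y : olt s x y -> near_side s' y (olt s x).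
Proof.
move=> xy; have [->|/neq_negb ->] := eqVneq s' s; last exact: near_sideN_olt.
by apply: filterS (near_beyond oM (BSide s y)) => t; exact: olt_trans.
Qed.

Lemma near_side_lt s s' x y : olt s y x -> near_side s' y (olt s ^~ x).
Proof.
by rewrite -oltN => /(near_side_gt s'); apply: filterS => t; rewrite oltN.
Qed.

(* The image of a monotone map accumulates at its infimum, hence by tameness contains an
   interval there; a monotone bijection between intervals is continuous.     *)
Lemma mono_continuous_ex s r a b : olt s a b ->
  (forall x y, olt s a x -> olt s x y -> olt s y b -> olt r (f x) (f y)) ->
  exists x, [/\ olt s a x, olt s x b & continuous_at x].
Proof.
move=> ab inc; have [c ac cb] := olt_dense oM ab.
pose V y := exists t, [/\ olt s c t, olt s t b & y = f t].
have dV : dpred S (fun e => V (e 0%N)).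
  apply: dpred_ex.
  apply: (@dpred_ext _ _ _ (fun e => olt s c (e 0%N) /\ (olt s (e 0%N) b /\
    e 1%N = f (e 0%N)))).
    by move=> e; split=> [[? []]|[]].
  apply: dpred_and; first exact: dpred_olt.
  apply: dpred_and; first exact: dpred_olt.
  by apply: (@dpred_app _ (fun x e => e 1%N = x)) => //; exact: dpred_eq.
have V0 : V !=set0 by have [t ct tb] := olt_dense oM cb; exists (f t), t.
have [|p pV Vp] := @sup_ex _ _ _ oM (~~ r) V dV V0.
  exists (f c) => _ [t [ct tb ->]]; rewrite oleN; apply: oltW.
  exact: inc.
have {}pV y : V y -> olt r p y.
  move=> [t [ct tb ->]]; have [u cu ut] := olt_dense oM ct.
  have : V (f u) by exists u; split=> //; exact: olt_trans tb.
  move=> /pV; rewrite oleN => /ole_lt_trans; apply.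
  by apply: inc => //; exact: olt_trans cu.
have [|h] := dpred_tame oM dV (BSide r p); last first.
  have [w pw {}h] := h; have [|y Vy] := Vp w; first by rewrite oltN.
  rewrite oltN => yw; have := h y; rewrite /past /= pV// yw => /(_ isT).
  by move=> /(_ Vy).
move=> [w /= pw h].
have {}h y : olt r p y -> olt r y w -> V y by move=> py yw; apply: h; rewrite /past /= py.
have [y1 py1 y1w] := olt_dense oM pw; have [y2 y12 y2w] := olt_dense oM y1w.
have [y0 y10 y02] := olt_dense oM y12.
have pre y : olt r p y -> olt r y w -> V y := h y.
have [t0 [ct0 t0b y0E]] := pre y0 (olt_trans py1 y10) (olt_trans y02 y2w).
have inj t u : olt s c t -> olt s t b -> olt s c u -> olt s u b ->
    olt r (f t) (f u) -> olt s t u.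
  move=> ct tb cu ub tu; have [//|tu'|ut] := olt_total s t u.
    by move: tu; rewrite tu' oltxx.
  by have := olt_asym tu (inc _ _ (olt_trans ac cu) ut tb).
exists t0; split=> //; first exact: olt_trans ct0.
(* A bound [u] on either side of [y0] can be tightened until it lies between [y1] and [y2], hence is
   a value of [f]; monotonicity then gives the neighbourhood. *)
have bound r' y1' u : olt r' y1' y0 -> olt r' u y0 -> exists y,
    [/\ olt r' y1' y, olt r' u y & olt r' y y0].
  move=> y1y0 uy0; have [uy1|] := boolP (ole r' u y1').
    have [y ? ?] := olt_dense oM y1y0; exists y; split=> //; exact: ole_lt_trans uy1 _.
  rewrite -oltNge => y1u; have [y ? ?] := olt_dense oM uy0.
  by exists y; split=> //; exact: olt_trans y1u _.
move=> r' u ut0 s'; rewrite -y0E in ut0.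
have [r'E|/neq_negb r'E] := eqVneq r' r; rewrite {r'}r'E in ut0 *.
  have [y [y1y uy yy0]] := bound _ _ _ y10 ut0.
  have [t' [ct' t'b yE]] := pre y (olt_trans py1 y1y) (olt_trans yy0 (olt_trans y02 y2w)).
  have t't0 : olt s t' t0 by apply: inj; rewrite -?yE -?y0E.
  apply: filterS2 (near_side_gt s' t't0) (near_side_lt s' t0b) => t t't tb.
  by apply: olt_trans uy _; rewrite yE; apply: inc => //; exact: olt_trans ct'.
have [|y [y2y uy y0y]] := bound (~~ r) y2 _ _ ut0; first by rewrite oltN.
rewrite !oltN in y2y uy y0y.
have [t' [ct' t'b yE]] := pre y (olt_trans py1 (olt_trans y10 y0y)) (olt_trans y2y y2w).
have t0t' : olt s t0 t' by apply: inj; rewrite -?yE -?y0E.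
apply: filterS2 (near_side_gt s' ct0) (near_side_lt s' t0t') => t ct tt'.
rewrite oltN; apply: olt_trans uy; rewrite yE.
by apply: inc => //; exact: olt_trans ct.
Qed.

(** How [f] compares with [f x] just on the side [s] of [x] is a definable condition on [x], so it
    is eventually the same near [E]; [None] stands for equality. *)
Lemma near_sign E s : exists o : option bool, near_end E (fun x =>
  if o is Some r then near_side s x (fun t => olt r (f x) (f t))
  else near_side s x (fun t => f t = f x)).
Proof.
have h r := @dpred_tame _ _ _ oM (fun x => near_side s x (fun t => olt r (f x) (f t)))
  (dpred_near_olt s r) E.
case: (h false) => h1; first by exists (Some false).
case: (h true) => h2; first by exists (Some true).
exists None; apply: filterS2 h1 h2 => x /= h1 h2.
by have [/h2|//|/h1] := near_trichotomy (BSide s x) false (f x).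
Qed.

(** Just to the right of [a], the behaviour on each side of a point is uniform. Constancy on one
    side gives continuity at a nearby point; equal signs would make every point a strict local
    extremum; opposite signs give monotonicity, hence a continuity point. *)
Lemma continuous_ex a b : a < b -> exists x, [/\ a < x, x < b & continuous_at x].
Proof.
move=> ab.
have [o ho] := near_sign (BSide false a) true.
have [o' ho'] := near_sign (BSide false a) false.
have [c /= ac h] := filterI (filterI ho ho') (near_side_lt (s := false) false ab).
have {ho ho'} {}h x : a < x -> x < c -> _ := fun ax xc => h x (introT andP (conj ax xc)).
have [x ax xc] := olt_dense oM (s := false) ac.
have cst s : (forall x, a < x -> x < c -> near_side s x (fun t => f t = f x)) ->
    exists x, [/\ a < x, x < b & continuous_at x].
  move=> hs; have [w xw hw] := filterI (hs x ax xc)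
    (filterI (near_side_gt s ax) (near_side_lt s xc)).
  have [y yp] := past_ex oM xw; have [_ [ay yc]] := hw y yp; exists y; split=> //.
    by have [] := h y ay yc.
  move=> r u uy s'.
  have : near_side s' y (past (BSide s x) w).
    move: yp => /= /andP[xy yw].
    apply: filterS2 (near_side_gt s' xy) (near_side_lt s' yw) => t xt tw.
    exact/andP.
  by apply: filterS => t /hw[-> _]; have [<- _] := hw y yp.
case: o o' h => [r|] [r'|] h; last 1 first.
- by apply: (cst true) => y ay yc; have [[]] := h y ay yc.
- have [rr'|/neq_negb rr'] := eqVneq r' r.
    exfalso; apply: (local_min_not_interval (s := false) (r := r) ac) => y ay yc.
    have [[h1 h2] _] := h y ay yc; case; first exact: h1.
    by move: h2; rewrite rr'.
  have [|y [ay yc cy]] := @mono_continuous_ex false r' a c ac.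
    apply: (@local_mono false) => y ay yc; have [[h1 h2] _] := h y ay yc; split=> //.
    by apply: filterS h1 => t; rewrite rr' oltN.
  by exists y; split=> //; have [] := h y ay yc.
- by apply: (cst false) => y ay yc; have [[]] := h y ay yc.
- by apply: (cst true) => y ay yc; have [[]] := h y ay yc.
Qed.

(** By tameness continuity holds or fails throughout near [E], and [continuous_ex] forbids failure
    on an interval. *)
Lemma near_continuous E : near_end E continuous_at.
Proof.
have dC : dpred S (fun e => continuous_at (e 0%N)).
  have hr r : dpred S (fun e => forall u, olt r u (f (e 0%N)) ->
      forall s, near_side s (e 0%N) (fun t => olt r u (f t))).
    apply: dpred_all; apply: dpred_imply.
      apply: dpred_ext (dpred_olt_app (~~ r) (dvar 1) (dvar 0)) => e.
      by rewrite oltN.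
    apply: dpred_forall_fin => s.
    apply: (@dpred_near_side _ _ _ _ _ (fun t e => olt r (e 0%N) (f t))) => //.
    apply: dpred_ext (dpred_olt_app (~~ r) (dvar 0) (dvar 1)) => e.
    by rewrite oltN.
  exact: dpred_forall_fin.
case: (dpred_tame oM dC E) => // -[w Ew h].
have [t tp] := past_ex oM Ew; have /andP[Et tw] := tp; have [t' /andP[Et' t't]] := past_ex oM Et.
have [x [t'x xt cx]] : exists x, [/\ olt (end_dir E) t' x, olt (end_dir E) x t & continuous_at x].
  by case: (end_dir E) t't => /continuous_ex[x []]; exists x.
case: (h x) => //; rewrite /past (olt_trans xt tw) andbT.
by case: (E) Et' t'x => //= s c; exact: olt_trans.
Qed.

End Continuity.

(** * Convergence in charts *)

Section ChartConvergence.
Context {d : Order.disp_t} {M : orderTopologicalType d}.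

Lemma open_olt r (u : M) : open [set y | olt r u y].
Proof.
case: r; [have := lray_open u|have := rray_open u]; congr open;
  by apply/seteqP; split=> y /=; rewrite in_itv/= ?andbT.
Qed.

Lemma nbhs_olt r (u y : M) : olt r u y -> nbhs y (olt r u).
Proof. by move=> uy; apply: open_nbhs_nbhs; split=> //; exact: open_olt. Qed.

Lemma nbhs_sides (x : M) (Q : set M) :
  Q x -> (forall s, near_side s x Q) -> nbhs x Q.
Proof.
move=> Qx hQ.
have /near_sideP[u /= ux hu] := hQ true; have /near_sideP[v xv hv] := hQ false.
apply: filterS2 (nbhs_olt (r := true) xv) (nbhs_olt (r := false) ux) => y yv uy.
by have [yx|->|xy] := olt_total false y x; [exact: hu| |exact: hv].
Qed.

Lemma cvg_rowP n (T : Type) (F : set_system T) (g : T -> 'rV[M]_n) (p : 'rV[M]_n) :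
  Filter F ->
  (forall i r u, olt r u (p ord0 i) -> F (fun t => olt r u (g t ord0 i))) ->
  g @ F --> p.
Proof.
move=> FF h A [P Pp PA].
have : F (fun t => forall i, P ord0 i (g t ord0 i)).
  apply: filter_forall => i; have := Pp ord0 i; rewrite itv_nbhsE.
  move=> [[lo hi] [oI +] IP]; rewrite mem_open_itv// => /andP[plo phi].
  have hE E : beyond E (p ord0 i) -> F (fun t => beyond E (g t ord0 i)).
    case: E => [s a|s _]; first exact: h.
    by apply: (filterS _ (@filterT _ F _)).
  apply: filterS2 (hE _ plo) (hE _ phi) => t tlo thi; apply: IP.
  by rewrite /= mem_open_itv// tlo.
move=> hF; suff : F (g @^-1` A) by [].
by apply: filterS hF => t ht; apply: PA => i j; rewrite (ord1 i).
Qed.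

Variable X : charted_space M.

Lemma cvg_chart (T : Type) (F : set_system T) (g : T -> X) j l : Filter F ->
  dom j l -> F (fun t => dom j (g t)) ->
  (forall i r u, olt r u (chart j l ord0 i) ->
    F (fun t => olt r u (chart j (g t) ord0 i))) ->
  g @ F --> l.
Proof.
move=> FF jl Fj Fc A; rewrite nbhsE => -[U [Uo Ul] UA].
have U'o : open (U `&` dom j) by apply: openI => //; exact: dom_open.
have [V Vo eV] := (chart_homeo (@subIsetr _ _ _)).1 U'o.
have Vl : V (chart j l).
  suff : (chart j @` dom j `&` V) (chart j l) by case.
  by rewrite -eV; exists l.
have FV : F (fun t => V (chart j (g t))).
  by apply: (cvg_rowP (g := fun t => chart j (g t)) FF Fc); exact: open_nbhs_nbhs.
suff : F (g @^-1` A) by [].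
apply: filterS2 Fj FV => t jt Vt; apply: UA.
have : (chart j @` dom j `&` V) (chart j (g t)) by split=> //; exists (g t).
by rewrite -eV => -[x [Ux jx] /(chart_inj jx jt) <-].
Qed.

Lemma open_chart_olt j i r u : open [set x : X | dom j x /\ olt r u (chart j x ord0 i)].
Proof.
apply/(chart_homeo (i := j)) => [x []//|].
exists [set v | olt r u (v ord0 i)].
  rewrite openE => v uv.
  exists (fun _ k => if k == i then [set y | olt r u y] else setT) => [k k'|w h].
    by case: eqP => [->|_]; [rewrite (ord1 k); exact: nbhs_olt|exact: filterT].
  by have := h ord0 i; rewrite eqxx.
apply/seteqP; split=> [_ [x [jx ux] <-]|_ [[x jx <-] ux]]; last by exists x.
by split=> //; exists x.
Qed.

Lemma cvg_dom (T : Type) (F : set_system T) (g : T -> X) j l : Filter F ->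
  g @ F --> l -> dom j l -> F (fun t => dom j (g t)).
Proof.
move=> FF gl jl; apply: (gl (dom j)); apply: open_nbhs_nbhs.
by split=> //; exact: dom_open.
Qed.

Lemma cvg_coord (T : Type) (F : set_system T) (g : T -> X) j l i r u : Filter F ->
  g @ F --> l -> dom j l -> olt r u (chart j l ord0 i) ->
  F (fun t => dom j (g t) /\ olt r u (chart j (g t) ord0 i)).
Proof.
move=> FF gl jl ul; apply: (gl [set x | dom j x /\ olt r u (chart j x ord0 i)]).
by apply: open_nbhs_nbhs; split=> //; exact: open_chart_olt.
Qed.

End ChartConvergence.

(** * Filters at the two ends of an interval *)

Section IntervalEnds.
Context {d : Order.disp_t} {M : orderTopologicalType d} (S : structure M).
Hypothesis oM : o_minimal S.

Lemma open_itv_ex (lo hi : itv_bound M) : open_itv (Interval lo hi) ->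
  exists c, beyond lo c && beyond hi c.
Proof.
case: lo hi => [[] a|[]] [[] b|[]] [//= _]; rewrite bnd_simp => ab.
- by have [z /andP[? ?]] := omin_dense oM ab; exists z; apply/andP.
- by have [z az] := omin_nomax oM a; exists z; rewrite az.
- exact: omin_nomin oM b.
- by have [z _] := omin_inhabited oM; exists z.
Qed.

(** Close to [E] the opposite bound [E'] is no restriction; this identifies the filters used for
    completability with [near_end]. *)
Lemma near_end_filter_from (E E' : itv_bound M) c : end_dir E' = ~~ end_dir E ->
  beyond E c && beyond E' c ->
  near_end E = filter_from [set t | beyond E t && beyond E' t]
    (fun c => [set t | beyond E t && beyond E' t /\ olt (end_dir E) t c]).
Proof.
move=> EE' /andP[Ec E'c].
have FF := near_end_filter oM E.
have E'W t u : beyond E' u -> olt (end_dir E) t u -> beyond E' t.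
  case: E' EE' {E'c} => [s a /= ->|//]; rewrite !oltN => ua tu; exact: olt_trans ua.
apply/seteqP; split=> Q [w].
  move=> Ew h; have [t /= [/andP[Et tw] /andP[_ tc]]] :=
    filter_ex (filterI (near_past Ew) (near_past Ec)).
  exists t => [|u [/andP[Eu _] ut]]; first by rewrite /= Et (E'W t c).
  by apply: h; rewrite /past Eu; exact: olt_trans tw.
move=> /andP[Ew E'w] h; exists w => // t /andP[Et tw]; apply: h; split=> //.
by rewrite Et (E'W t w).
Qed.

Lemma at_left_endE (lo hi : itv_bound M) : open_itv (Interval lo hi) ->
  at_left_end (Interval lo hi) = near_end lo.
Proof.
move=> oI; have [c hc] := open_itv_ex oI; have [lod hid] := open_ends_dir oI.1.
rewrite (near_end_filter_from _ hc); last by rewrite hid lod.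
rewrite lod /at_left_end; congr (filter_from _ _).
  by apply/seteqP; split=> t /=; rewrite (mem_open_itv _ oI.1).
by apply/funext => u; apply/seteqP; split=> t /=; rewrite (mem_open_itv _ oI.1).
Qed.

Lemma at_right_endE (lo hi : itv_bound M) : open_itv (Interval lo hi) ->
  at_right_end (Interval lo hi) = near_end hi.
Proof.
move=> oI; have [c hc] := open_itv_ex oI; have [lod hid] := open_ends_dir oI.1.
rewrite andbC in hc; rewrite (near_end_filter_from _ hc); last by rewrite hid lod.
rewrite hid /at_right_end; congr (filter_from _ _).
  by apply/seteqP; split=> t /=; rewrite (mem_open_itv _ oI.1) andbC.
by apply/funext => u; apply/seteqP; split=> t /=; rewrite (mem_open_itv _ oI.1) andbC.
Qed.

End IntervalEnds.

(** * Limits of definable curves *)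

Section DefinableFamilies.
Context {d : Order.disp_t} {M : orderTopologicalType d} (S : structure M).
Variable X : charted_space M.

Local Notation env := (nat -> M).

(* The graph of [chart j \o G] is definable: the first [dim j] entries of the
   environment hold its value, and the remaining ones its argument.           *)
Definition dfamily (G : env -> X) : Prop := forall j : 'I_(ncharts X),
  dpred S (fun e => dom j (G (fun i => e (dim j + i)%N)) /\
    chart j (G (fun i => e (dim j + i)%N)) = \row_(i < dim j) e i).

Lemma dfamily_chart (G : env -> X) j (Q : ('I_(dim j) -> M) -> env -> Prop) :
  dfamily G -> dpred S (fun e => Q (fun i => e i) (fun i => e (dim j + i)%N)) ->
  dpred S (fun e => dom j (G e) /\ Q (chart j (G e) ord0) e).
Proof.
move=> dG dQ; apply: (@dpred_ext _ _ _ (fun e => exists f : 'I_(dim j) -> M,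
    (dom j (G e) /\ chart j (G e) = \row_i f i) /\ Q f e)).
  move=> e; split=> [[f [[Gj Gf] Qf]]|[Gj Qe]].
    rewrite Gf; split=> //; suff -> : (\row_i f i) ord0 = f by [].
    by apply/funext => i; rewrite mxE.
  exists (chart j (G e) ord0); split=> //; split=> //.
  by apply/rowP => i; rewrite mxE.
by apply: dpred_ex_fun; exact: dpred_and.
Qed.

Lemma dfamily_dom (G : env -> X) j : dfamily G -> dpred S (fun e => dom j (G e)).
Proof.
move=> dG; apply: dpred_ext (@dfamily_chart G j (fun _ _ => True) dG (dpred_cst _ _)) => e.
by split=> [[]|h].
Qed.

Lemma dfamily_sub (G : env -> X) (t : nat -> env -> M) :
  dfamily G -> (forall i, dterm (t i)) -> dfamily (fun e => G (fun i => t i e)).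
Proof.
move=> dG dt j.
pose t' i (e : env) : M :=
  if (i < dim j)%N then e i else t (i - dim j)%N (fun k => e (dim j + k)%N).
have dt' i : dterm (t' i).
  rewrite /t'; case: (i < dim j)%N; first exact: dvar.
  by case: (dt (i - dim j)%N) => [k|c]; [exact: dvar|exact: dcst].
apply: dpred_ext (dpred_sub (dG j) dt') => e.
have -> : (fun i => t' (dim j + i)%N e) = fun i => t i (fun k => e (dim j + k)%N).
  by apply/funext => i; rewrite /t' ltnNge leq_addr /= addKn.
suff -> : (\row_(i < dim j) t' i e) = \row_(i < dim j) e i by [].
by apply/rowP => i; rewrite !mxE /t' ltn_ord.
Qed.

End DefinableFamilies.

Section Limits.
Context {d : Order.disp_t} {M : orderTopologicalType d} (S : structure M).
Hypothesis oM : o_minimal S.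
Variable X : charted_space M.
Hypothesis cX : definably_compact S X.

Local Notation env := (nat -> M).

Let end_filter E : ProperFilter (near_end E) := near_end_filter oM E.
#[local] Existing Instance end_filter.

Lemma near_chart (g : M -> X) E : dfamily S (fun e => g (e 0%N)) ->
  exists j, near_end E (fun t => dom j (g t)).
Proof.
move=> dg; apply: contrapT => nj.
have h j : near_end E (fun t => ~ dom j (g t)).
  have [|//] := @dpred_tame _ _ _ oM (fun t => dom j (g t)) (dfamily_dom j dg) E.
  by move=> hj; exfalso; apply: nj; exists j.
have [t nt] := filter_ex (filter_forall _ h).
have : (\bigcup_j @dom _ _ X j) (g t) by rewrite dom_cover.
by case=> j _ /nt.
Qed.

(** The continuity results concern total functions [M -> M], hence the default value [c] outside the
    chart domain. *)
Lemma coord_definable (g : M -> X) j (i : 'I_(dim j)) c : dfamily S (fun e => g (e 0%N)) ->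
  dpred S (fun e => e 0%N =
    (fun t => if pselect (dom j (g t)) then chart j (g t) ord0 i else c) (e 1%N)).
Proof.
move=> dg; have dg1 : dfamily S (fun e => g (e 1%N)).
  exact: (dfamily_sub (t := fun _ e => e 1%N) dg).
apply: (@dpred_ext _ _ _ (fun e =>
    (dom j (g (e 1%N)) /\ e 0%N = chart j (g (e 1%N)) ord0 i) \/
    (~ dom j (g (e 1%N)) /\ e 0%N = c))).
  move=> e; case: pselect => gj; split.
  - by case=> [[]//|[/(_ gj)]].
  - by left.
  - by case=> [[/gj]//|[]].
  - by right.
apply: dpred_or.
  apply: (dfamily_chart (Q := fun f e => e 0%N = f i) dg1).
  exact: dpred_eq.
apply: dpred_and; last exact: dpred_eq.
by apply/dpred_not/dfamily_dom.
Qed.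

(** Continuity of [g] is not assumed: near [E] it stays in one chart, where its finitely many
    coordinates are continuous, so a restriction of [g] to a short interval at [E] is a definable
    curve. *)
Lemma curve_limit (g : M -> X) E : dfamily S (fun e => g (e 0%N)) ->
  exists l : X, g @ near_end E --> l.
Proof.
move=> dg; have [j Ej] := near_chart E dg.
have [c _] := omin_inhabited oM.
pose h (i : 'I_(dim j)) t := if pselect (dom j (g t)) then chart j (g t) ord0 i else c.
have hc i : near_end E (continuous_at (h i)) := near_continuous oM (coord_definable i c dg) E.
have [w Ew hw] := filterI Ej (filter_forall _ hc).
pose I := if end_dir E then Interval (BRight w) E else Interval E (BLeft w).
have Iw t : (t \in I) = past E w t.
  by rewrite /I /past; case: (E) => [[] a|[]] /=; rewrite in_itv /olt /= ?andbT // andbC.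
have oI : open_itv I.
  by rewrite /I; case: (E) Ew => [[] a|[]] /=; rewrite /olt /open_itv //= ?bnd_simp.
have dI : dpred S (fun e => e 0%N \in I).
  by apply: dpred_ext (dpred_past S E (dcst w) (dvar 0)) => e; rewrite Iw.
have [gl gr] : completable I g.
  apply: cX; split=> // [|k].
    apply: continuous_in_subspaceT => t; rewrite inE /= => tI.
    have nI := open_nbhs_nbhs (conj (itv_open_ends_open oI.1) (tI : [set` I] t)).
    have nj : nbhs t (fun t => dom j (g t)).
      by apply: filterS nI => u; rewrite /= Iw => /hw[].
    have [gj hcont] := hw t (etrans (esym (Iw t)) tI).
    apply: (cvg_chart _ gj nj) => i r u uh.
    have ht v : dom j (g v) -> h i v = chart j (g v) ord0 i.
      by move=> gv; rewrite /h; case: pselect.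
    rewrite -ht// in uh.
    have nh : nbhs t (fun v => olt r u (h i v)) by apply: nbhs_sides => // s; exact: hcont.
    by apply: filterS2 nj nh => v gv; rewrite ht.
  split.
    apply: (definable_dpred1 c (A := [set t | t \in I /\ dom k (g t)])).
    by apply: dpred_and; last exact: dfamily_dom.
  (* In the graph of a curve the argument precedes the coordinates, contrary to [dfamily]: entry [0]
     is the argument and entry [i.+1] the coordinate [i]. *)
  have dgk : dpred S (fun e => e 0%N \in I /\ (dom k (g (e 0%N)) /\
      forall i : 'I_(dim k), e i.+1 = chart k (g (e 0%N)) ord0 i)).
    apply: dpred_and => //.
    apply: (dfamily_chart (Q := fun f e => forall i : 'I_(dim k), e i.+1 = f i) dg).
    by apply: dpred_forall_fin => i; exact: (dpred_eq S (dvar (dim k + i.+1)) (dvar i)).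
  have := definable_dpred (1 + dim k) c dgk.
  set A := [set _ | _]; set B := [set _ | _ in _]; suff -> : A = B by [].
  have v0 (v : 'rV_(1 + dim k)) : extend c v 0 = v ord0 (lshift (dim k) ord0).
    exact: (extendE c v (lshift (dim k) ord0)).
  have vS (v : 'rV_(1 + dim k)) (i : 'I_(dim k)) : extend c v i.+1 = v ord0 (rshift 1 i).
    exact: (extendE c v (rshift 1 i)).
  apply/seteqP; split=> [v|_ [t [tI gt] <-]].
    rewrite /A /= v0 => -[vI [gv hv]]; exists (v ord0 (lshift (dim k) ord0)) => //.
    apply/rowP => i; rewrite mxE; case: splitP => l il; rewrite ?mxE -?hv ?vS;
      by congr (v _ _); apply/val_inj; rewrite /= il ?(ord1 l).
  rewrite /A /= v0 row_mxEl mxE; split=> //; split=> // i.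
  by rewrite vS row_mxEr.
rewrite /I in oI gl gr; case: (end_dir E) oI gl gr => oI gl gr.
  by rewrite -(at_right_endE oM oI).
by rewrite -(at_left_endE oM oI).
Qed.

End Limits.

(** * Iterated limits *)

Section RowPredicates.
Context {d : Order.disp_t} {M : orderType d} (S : structure M).

Lemma row_mx_row m n (f : 'I_m -> M) (g : 'I_n -> M) :
  row_mx (\row_i f i) (\row_i g i) =
  \row_l match split l with inl i => f i | inr i => g i end.
Proof. by apply/rowP => l; rewrite !mxE; case: split => i; rewrite mxE. Qed.

Lemma dpred_set_row_mx m n (A : set 'rV[M]_(m + n))
    (f : 'I_m -> (nat -> M) -> M) (g : 'I_n -> (nat -> M) -> M) :
  definable S A -> (forall i, dterm (f i)) -> (forall i, dterm (g i)) ->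
  dpred S (fun e => A (row_mx (\row_i f i e) (\row_i g i e))).
Proof.
move=> dA df dg.
pose t (l : 'I_(m + n)) := match split l with inl i => f i | inr i => g i end.
have dt l : dterm (t l) by rewrite /t; case: split.
apply: dpred_ext (dpred_set dA dt) => e; rewrite row_mx_row /t.
set u := \row_l _; set v := \row_l _; suff -> : u = v by [].
by apply/rowP => l; rewrite !mxE; case: split.
Qed.

Lemma dpred_eq_rows n (f g : 'I_n -> (nat -> M) -> M) :
  (forall i, dterm (f i)) -> (forall i, dterm (g i)) ->
  dpred S (fun e => \row_i f i e = \row_i g i e).
Proof.
move=> df dg; apply: dpred_ext (dpred_forall_fin (fun i => dpred_eq S (df i) (dg i))) => e.
split=> [h|/rowP h i]; first by apply/rowP => i; rewrite !mxE h.
by have := h i; rewrite !mxE.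
Qed.

Lemma dpred_eq_row n (v : 'rV[M]_n) (f : 'I_n -> (nat -> M) -> M) :
  (forall i, dterm (f i)) -> dpred S (fun e => v = \row_i f i e).
Proof.
move=> df; apply: dpred_ext (dpred_eq_rows (f := fun i _ => v ord0 i) (fun=> dcst _) df) => e.
by suff -> : \row_i v ord0 i = v by []; apply/rowP => i; rewrite mxE.
Qed.

End RowPredicates.

Section IteratedLimits.
Context {d : Order.disp_t} {M : orderTopologicalType d} (S : structure M).
Hypothesis oM : o_minimal S.
Variable X : charted_space M.
Hypothesis dS : definable_space S X.

Local Notation env := (nat -> M).

Let end_filter E : ProperFilter (near_end E) := near_end_filter oM E.
#[local] Existing Instance end_filter.

Definition scons (t : M) (e : env) : env := fun i => if i is k.+1 then e k else t.

(** Convergence to a point of [dom j] is expressed by half-lines in the coordinates of that chart,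
    which is first-order; the Hausdorff property identifies the point so described with the chosen
    limit. *)
Lemma dfamily_limit (G Gl : env -> X) E : hausdorff_space X -> dfamily S G ->
  (forall e, (fun t => G (scons t e)) @ near_end E --> Gl e) -> dfamily S Gl.
Proof.
move=> hX dG hGl j; set k := dim j.
pose tl (e : env) : env := fun i => e (k + i)%N.
apply: (@dpred_ext _ _ _ (fun e => (chart j @` dom j) (\row_(i < k) e i) /\
  (near_end E (fun t => dom j (G (scons t (tl e)))) /\
  forall (i : 'I_k) (r : bool) u, olt r u (e i) ->
    near_end E (fun t => dom j (G (scons t (tl e))) /\
      olt r u (chart j (G (scons t (tl e))) ord0 i))))).
  move=> e; split=> [[[x jx xe] [Gj Gc]]|[Glj Gle]].
    suff -> : Gl (tl e) = x by [].
    have Gx : (fun t => G (scons t (tl e))) @ near_end E --> x.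
      apply: (cvg_chart _ jx Gj) => i r u.
      by rewrite xe mxE => /Gc; apply: filterS => t [].
    apply: hX => U V UG Vx.
    exact: (filter_ex (filterI (hGl (tl e) U UG) (Gx V Vx))).
  split; first by exists (Gl (tl e)).
  split; first exact: (cvg_dom _ (hGl (tl e)) Glj).
  move=> i r u ui; apply: (cvg_coord _ (hGl (tl e))) => //.
  by rewrite Gle mxE.
have dGs n : dfamily S (fun e => G (scons (e 0%N) (fun i => e (n + i)%N))).
  apply: (dfamily_sub (t := fun i e => if i is m.+1 then e (n + m)%N else e 0%N) dG).
  by case.
apply: dpred_and; first by apply: (dpred_set (dS j).1) => i; exact: dvar.
apply: dpred_and.
  by apply: dpred_near_end; exact: (dfamily_dom j (dGs k.+1)).
apply: dpred_forall_fin => i; apply: dpred_forall_fin => r.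
apply: dpred_all; apply: dpred_imply; first exact: dpred_olt.
apply: dpred_near_end.
apply: (dfamily_chart (Q := fun f e => olt r (e 1%N) (f i)) (dGs k.+2)).
exact: dpred_olt.
Qed.

(** Variable [0] goes to its end first, leaving a definable family in the others. By induction [U]
    contains some [Gl e], and being open it contains [G (scons t e)] for [t] near its end. *)
Lemma iterated_limit : definably_compact S X -> hausdorff_space X ->
  forall N (K : nat -> itv_bound M) (G : env -> X), dfamily S G ->
  exists l : X, forall U, open U -> U l ->
  forall w : env, (forall i, (i < N)%N -> beyond (K i) (w i)) ->
  exists2 e, forall i, (i < N)%N -> past (K i) (w i) (e i) & U (G e).
Proof.
move=> cX hX; elim=> [|N IH] K G dG.
  have [c _] := omin_inhabited oM.
  by exists (G (fun=> c)) => U _ Ul w _; exists (fun=> c).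
have /choice[Gl hGl] e : exists l : X, (fun t => G (scons t e)) @ near_end (K 0%N) --> l.
  apply: (curve_limit oM cX).
  apply: (dfamily_sub (t := fun i e' => if i is m.+1 then e m else e' 0%N) dG).
  by case.
have [l hl] := IH (fun i => K i.+1) Gl (dfamily_limit hX dG hGl).
exists l => U Uo Ul w hw.
have [e he Ue] := hl U Uo Ul (fun i => w i.+1) (fun i => hw i.+1).
have nU : near_end (K 0%N) (fun t => U (G (scons t e))).
  by apply: (hGl e U); exact: open_nbhs_nbhs.
have [t [Ut wt]] := filter_ex (filterI nU (near_past (hw 0%N isT))).
by exists (scons t e) => // -[_|i /he].
Qed.

(** Skolem functions select rows; a total inverse of a chart turns them into points of [X]. *)
Definition chart_inv (x0 : X) j (y : 'rV[M]_(dim j)) : X :=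
  if pselect (exists x, dom j x /\ chart j x = y) is left h then projT1 (cid h) else x0.

Lemma chartK x0 j x : dom j x -> chart_inv x0 (chart j x) = x.
Proof.
move=> jx; rewrite /chart_inv; case: pselect => [h|[]]; last by exists x.
by case: cid => y [jy] /= /(chart_inj jy jx).
Qed.

Lemma chart_inv_out x0 j (y : 'rV[M]_(dim j)) :
  ~ (chart j @` dom j) y -> chart_inv x0 y = x0.
Proof.
rewrite /chart_inv; case: pselect => // -[x [jx xy]] []; by exists x.
Qed.

Lemma dfamily_chart_inv x0 j (b : env -> 'rV[M]_(dim j)) :
  dpred S (fun e => b (fun i => e (dim j + i)%N) = \row_(i < dim j) e i) ->
  dfamily S (fun e => chart_inv x0 (b e)).
Proof.
move=> db k; set n := dim j; set m := dim k.
pose tl (e : env) : env := fun i => e (m + i)%N.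
have db' : dpred S (fun e => b (fun i => e (n + (m + i))%N) = \row_(i < n) e i).
  pose t i (e : env) := if (i < n)%N then e i else e (n + (m + (i - n)))%N.
  have dt i : dterm (t i) by rewrite /t; case: (i < n)%N; exact: dvar.
  apply: dpred_ext (dpred_sub db dt) => e.
  have -> : (fun i => t (dim j + i)%N e) = fun i => e (n + (m + i))%N.
    by apply/funext => i; rewrite /t ltnNge leq_addr /= addKn.
  suff -> : (\row_(i < dim j) t i e) = \row_(i < n) e i by [].
  by apply/rowP => i; rewrite !mxE /t ltn_ord.
(* The coordinates in chart [k] come from the graph of the transition map if the row [y] is in the
   image of chart [j], and from [x0] otherwise. *)
apply: (@dpred_ext _ _ _ (fun e => exists y : 'I_n -> M, b (tl e) = \row_i y i /\
   ([set row_mx (chart j x) (chart k x) | x in dom j `&` dom k]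
      (row_mx (\row_i y i) (\row_(i < m) e i)) \/
   ~ (chart j @` dom j) (\row_i y i) /\
     (dom k x0 /\ chart k x0 = \row_(i < m) e i)))).
  move=> e; split=> [[y [-> [[x [jx kx] /eq_row_mx[<- xe]]|[ny [kx0 x0e]]]]]|[kb be]].
  - by rewrite chartK.
  - by rewrite chart_inv_out.
  - exists (b (tl e) ord0); have by_ : b (tl e) = \row_i b (tl e) ord0 i.
      by apply/rowP => i; rewrite mxE.
    split=> //; rewrite -by_ -be -/(tl e).
    have [[x jx xb]|nb] := pselect ((chart j @` dom j) (b (tl e))).
      left; move: kb; rewrite -/(tl e) -xb chartK// => kx.
      by exists x.
    by right; move: kb; rewrite -/(tl e) chart_inv_out.
apply: dpred_ex_fun; apply: dpred_and => //.
apply: dpred_or.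
  by apply: (dpred_set_row_mx (f := fun i e => e i) (g := fun i e => e (n + i)%N)
    (((dS j).2 k).2)) => i; exact: dvar.
apply: dpred_and; first by apply/dpred_not/(dpred_set (dS j).1) => i; exact: dvar.
apply: dpred_and; first exact: dpred_cst.
by apply: (dpred_eq_row _ _ (f := fun i e => e (n + i)%N)) => i; exact: dvar.
Qed.

End IteratedLimits.

(** * Cluster points of definable boxes *)

Section ClosedNeighbourhoods.
Context {d : Order.disp_t} {M : orderType d} (S : structure M).
Hypothesis oM : o_minimal S.

Let end_filter E : ProperFilter (near_end E) := near_end_filter oM E.
#[local] Existing Instance end_filter.

(* The endpoint is included because a coordinate of a curve may be constant. *)
Definition end_nbh (E : itv_bound M) (w y : M) : bool :=
  (if E is BSide s a then ole s a y else true) && olt (end_dir E) y w.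

Lemma end_nbhS E w w' y : past E w w' -> end_nbh E w' y -> end_nbh E w y.
Proof.
by move=> /andP[_ w'w] /andP[Ey yw']; rewrite /end_nbh Ey /=; exact: olt_trans w'w.
Qed.

Lemma dpred_end_nbh E (t u : (nat -> M) -> M) : dterm t -> dterm u ->
  dpred S (fun e => end_nbh E (t e) (u e)).
Proof.
move=> dt du; apply: (@dpred_ext _ _ _ (fun e =>
    (if E is BSide s a then ~ olt s (u e) a else True) /\ olt (end_dir E) (u e) (t e))).
  move=> e; rewrite /end_nbh; case: (E) => [s a|s]; last by split=> [[]|/andP[]].
  by rewrite oleNgt; split=> [[/negP ? ?]|/andP[/negP ? ?]]; [apply/andP|].
apply: dpred_and; last exact: dpred_olt.
case: E => [s a|s]; last exact: dpred_cst.
by apply: dpred_not; exact: dpred_olt.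
Qed.

(** [K] is read off from the set [A] of eventual strict lower bounds: an infinity if [A] is empty or
    unbounded, else its supremum [p], approached from below if [f] is eventually below [p] and from
    above if not. The latter case includes [f] eventually equal to [p]. *)
Lemma limit_end (f : M -> M) E : dpred S (fun e => e 0%N = f (e 1%N)) ->
  exists K, forall w, beyond K w -> near_end E (fun t => end_nbh K w (f t)).
Proof.
move=> df; pose A y := near_end E (fun t => olt false y (f t)).
have dA : dpred S (fun e => A (e 0%N)).
  apply: (dpred_near_end E (P := fun t e => olt false (e 0%N) (f t))).
  exact: (dpred_olt_app df true (dvar 0) (dvar 1)).
have nA y w : ~ A y -> olt false y w -> near_end E (fun t => olt false (f t) w).
  move=> nAy yw; case: (near_trichotomy oM df E false y) => // h; apply: filterS h => t.
    by move=> ty; exact: olt_trans yw.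
  by move=> ->.
have [A0|nA0] := pselect (A !=set0); last first.
  exists (BInfty _ true) => w _; have [w' w'w] := olt_unbounded oM true w.
  by apply: filterS (nA w' w _ w'w) => // /(ex_intro A).
have [[u Au]|nu] := pselect (exists u, forall x, A x -> ole false x u); last first.
  exists (BInfty _ false) => w _.
  have [x Ax wx] : exists2 x, A x & olt false w x.
    apply: contrapT => nx; apply: nu; exists w => x Ax; rewrite oleNgt; apply/negP => wx.
    by apply: nx; exists x.
  by apply: filterS Ax => t; exact: olt_trans wx.
have [p Ap pA] := sup_ex oM dA A0 (ex_intro _ u Au).
have [fp|np] := pselect (near_end E (fun t => olt false (f t) p)).
  exists (BSide true p) => w /pA[x Ax wx].
  apply: filterS2 Ax fp => t xt tp; rewrite /end_nbh (oltW tp : ole true p (f t)) /=.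
  exact: olt_trans wx xt.
exists (BSide false p) => w /(olt_dense oM)[w' pw' w'w].
have hp : near_end E (fun t => ole false p (f t)).
  case: (near_trichotomy oM df E false p) => // h; apply: filterS h => t.
    by move=> ->; exact: olexx.
  exact: oltW.
have hw : near_end E (fun t => olt false (f t) w).
  by apply: nA w'w => /Ap; rewrite oleNgt pw'.
by apply: filterS2 hp hw => t ? ?; apply/andP.
Qed.

End ClosedNeighbourhoods.

Section ClusterPoint.
Context {d : Order.disp_t} {M : orderTopologicalType d} (S : structure M).
Hypothesis oM : o_minimal S.
Variable X : charted_space M.
Hypotheses (dS : definable_space S X) (hX : hausdorff_space X).
Hypotheses (cX : definably_compact S X) (skS : has_definable_skolem S).

Local Notation env := (nat -> M).
Local Notation params := (forall j : 'I_(ncharts X), 'I_(dim j) -> M).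

Variable J : 'I_(ncharts X) -> bool.
Variable K : forall j : 'I_(ncharts X), 'I_(dim j) -> itv_bound M.

Definition params_ok (w : params) : Prop := forall j i, beyond (K i) (w j i).

(** Avoiding the charts outside [J] is what will force the charts around a cluster point to belong
    to [J]. *)
Definition in_box (w : params) (x : X) : Prop := forall j,
  if J j then dom j x /\ forall i, end_nbh (K i) (w j i) (chart j x ord0 i)
  else ~ dom j x.

Lemma in_boxS (w w' : params) x : (forall j i, past (K i) (w j i) (w' j i)) ->
  in_box w' x -> in_box w x.
Proof.
move=> ww' h j; have := h j; case: (J j) => // -[jx hx]; split=> // i.
exact: end_nbhS (ww' j i) (hx i).
Qed.

(** Pairs of a chart and a coordinate are numbered, so that the parameters form a row to which a
    Skolem function applies. *)
Let T := {j : 'I_(ncharts X) & 'I_(dim j)}.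
Let rank j (i : 'I_(dim j)) : 'I_#|{: T}| := enum_rank (Tagged _ i : T).
Let env_params (e : env) : params := fun j i => e (rank i).

Lemma dpred_params_ok : dpred S (fun e => params_ok (env_params e)).
Proof.
apply: dpred_forall_fin => j; apply: dpred_forall_fin => i.
exact: (dpred_beyond S _ (dvar (rank i))).
Qed.

Lemma dpred_in_box (G : env -> X) : dfamily S G ->
  dpred S (fun e => in_box (env_params e) (G e)).
Proof.
move=> dG; apply: dpred_forall_fin => j; case: (J j); last first.
  by apply: dpred_not; exact: dfamily_dom.
apply: (dfamily_chart (Q := fun f e => forall i, end_nbh (K i) (env_params e i) (f i)) dG).
apply: dpred_forall_fin => i.
exact: (dpred_end_nbh S _ (dvar (dim j + rank i)) (dvar i)).
Qed.

(* A Skolem function picks a point of each box; its iterated limit, one parameter at a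
   time, is adherent to all the boxes. *)
Lemma cluster_point j0 : J j0 ->
  (forall w, params_ok w -> exists x, in_box w x) ->
  exists l : X, forall U, open U -> U l -> forall w, params_ok w ->
    exists2 x, U x & in_box w x.
Proof.
move=> Jj0 ne; have [c _] := omin_inhabited oM.
have [w1 hw1] : exists w, params_ok w.
  by exists (fun j i => projT1 (cid (beyond_ex oM (K i)))) => j i; case: cid.
have [x0 _] := ne w1 hw1.
pose m := #|{: T}|; pose n := dim j0.
pose Tset : set 'rV[M]_m := [set t | params_ok (env_params (extend c t))].
(* Since [j0] is in [J], boxes lie in [dom j0], and their points are represented by rows of
   coordinates in that chart. *)
pose F (t : 'rV[M]_m) : set 'rV[M]_n := [set y | (chart j0 @` dom j0) y /\
  in_box (env_params (extend c t)) (chart_inv x0 y)].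
have dT : definable S Tset := definable_dpred m c dpred_params_ok.
have dG2 : dfamily S (fun e => chart_inv x0 (\row_(i < n) e (m + i)%N)).
  apply: (dfamily_chart_inv dS).
  by apply: (dpred_eq_rows S (f := fun i e => e (n + (m + i))%N)) => i; exact: dvar.
have dF : definable S [set u | exists t y, [/\ Tset t, F t y & u = row_mx t y]].
  have dP : dpred S (fun e => params_ok (env_params e) /\
      ((chart j0 @` dom j0) (\row_(i < n) e (m + i)%N) /\
      in_box (env_params e) (chart_inv x0 (\row_(i < n) e (m + i)%N)))).
    apply: dpred_and; first exact: dpred_params_ok.
    apply: dpred_and; last exact: dpred_in_box.
    by apply: (dpred_set (dS j0).1 (t := fun i e => e (m + i)%N)) => i; exact: dvar.
  have := definable_dpred (m + n) c dP.
  set A := [set _ | _]; set B := [set _ | _]; suff -> : A = B by [].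
  have EP (t : 'rV_m) (y : 'rV_n) :
      env_params (extend c (row_mx t y)) = env_params (extend c t).
    apply/functional_extensionality_dep => j; apply/funext => i.
    rewrite /env_params (extendE c t) -(row_mxEl t y).
    exact: (extendE c _ (lshift n (rank i))).
  have ER (t : 'rV_m) (y : 'rV_n) : \row_(i < n) extend c (row_mx t y) (m + i)%N = y.
    apply/rowP => i; rewrite mxE -(row_mxEr t y).
    exact: (extendE c _ (rshift m i)).
  apply/seteqP; split=> [u|_ [t [y [Tt Fy ->]]]]; rewrite /A /B /=.
    rewrite -[u]hsubmxK EP ER => -[h1 h2].
    by exists (lsubmx u), (rsubmx u).
  by rewrite EP ER.
have neF t : Tset t -> F t !=set0.
  move=> /ne[x hx]; have := hx j0; rewrite Jj0 => -[j0x _].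
  by exists (chart j0 x); split; [exists x|rewrite chartK].
have [b [[_ db] hb]] := skS dT dF neF.
(* The Skolem function is known to be definable on [Tset] only, so a constant replaces it
   elsewhere. *)
pose bb (e : env) := if pselect (Tset (\row_(i < m) e i)) then b (\row_(i < m) e i)
  else const_mx c.
have dbb : dfamily S (fun e => chart_inv x0 (bb e)).
  apply: (dfamily_chart_inv dS).
  apply: (@dpred_ext _ _ _ (fun e =>
    [set row_mx t (b t) | t in Tset]
      (row_mx (\row_(i < m) e (n + i)%N) (\row_(i < n) e i)) \/
    ~ Tset (\row_(i < m) e (n + i)%N) /\ const_mx c = \row_(i < n) e i)).
    move=> e; rewrite /bb; case: pselect => Te /=; split.
    - by case=> [[t Tt /eq_row_mx[<- ->]]|[]].
    - by move=> be; left; exists (\row_(i < m) e (n + i)%N); rewrite ?be.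
    - by case=> [[t Tt /eq_row_mx[tE _]]|[]//]; case: Te; rewrite -tE.
    - by right.
  apply: dpred_or.
    by apply: (dpred_set_row_mx (f := fun i e => e (n + i)%N) (g := fun i e => e i) db)
      => i; exact: dvar.
  apply: dpred_and.
    by apply/dpred_not/(dpred_set dT (t := fun i e => e (n + i)%N)) => i; exact: dvar.
  by apply: dpred_eq_row => i; exact: dvar.
pose K' (k : nat) : itv_bound M :=
  if insub k is Some k' then K (tagged (enum_val (k' : 'I_m))) else BInfty _ true.
have K'E j (i : 'I_(dim j)) : K' (rank i) = K i by rewrite /K' valK enum_rankK.
have [l hl] := iterated_limit oM dS cX hX m K' dbb.
exists l => U Uo Ul w hw.
pose w0 (k : nat) : M :=
  if insub k is Some k' then w _ (tagged (enum_val (k' : 'I_m))) else c.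
have w0E j (i : 'I_(dim j)) : w0 (rank i) = w j i by rewrite /w0 valK enum_rankK.
have [|e he Ue] := hl U Uo Ul w0.
  by move=> k km; rewrite /K' /w0 insubT; exact: hw.
(* The parameters found by the iterated limit are closer to the ends than [w], so their box lies in
   that of [w]. *)
have hpast j (i : 'I_(dim j)) : past (K i) (w j i) (e (rank i)).
  by have := he (rank i) (ltn_ord _); rewrite K'E w0E.
have EE : env_params (extend c (\row_(i < m) e i)) = env_params e.
  apply/functional_extensionality_dep => j; apply/funext => i.
  by rewrite /env_params (extendE c _ (rank i)) mxE.
have Te : Tset (\row_(i < m) e i).
  by move=> j i; rewrite EE; have /andP[] := hpast j i.
exists (chart_inv x0 (bb e)) => //.
have [_] := hb _ Te; rewrite EE /bb; case: pselect => [Te' /=|//].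
exact: in_boxS.
Qed.

End ClusterPoint.

(** * Curves definable in an expansion *)

Section CurvesInExpansion.
Context {d : Order.disp_t} {M : orderTopologicalType d}.
Variables (MM SS : structure M) (X : charted_space M).
Hypotheses (oM : o_minimal MM) (oS : o_minimal SS).
Hypotheses (skM : has_definable_skolem MM) (dM : definable_space MM X).
Hypotheses (hX : hausdorff_space X) (cX : definably_compact MM X).

Let end_filter E : ProperFilter (near_end E) := near_end_filter oM E.
#[local] Existing Instance end_filter.

(** This will identify the coordinates of a cluster point. If [q] is on the approached side of [a],
    a point between them separates; if it is on the other side, [a] itself bounds the half-line; for
    an infinity, any point between it and [q] works. *)
Lemma separate_end (K : itv_bound M) q : (if K is BSide s a then a <> q else True) ->
  exists2 w, beyond K w & exists r u, olt r u q /\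
    forall y, olt r u y -> end_nbh K w y -> False.
Proof.
case: K => [s a|s] aq.
  have [aq'|//|qa] := olt_total s a q.
    have [w aw wq] := olt_dense oM aq'; exists w => //; exists s, w; split=> // y wy.
    by move=> /andP[_]; exact: olt_asym.
  have [w aw] := olt_unbounded oM s a; exists w => //; exists (~~ s), a.
  by split=> [|y]; rewrite ?oltN// => ya /andP[]; rewrite oleNgt ya.
have [w qw] := olt_unbounded oM s q; exists w => //; exists (~~ s), w.
split=> [|y]; rewrite ?oltN// => yw /andP[_] /=; rewrite oltN => wy.
exact: olt_asym wy.
Qed.

Lemma dfamily_curve (I : interval M) (alpha : M -> X) x0 :
  definable_curve SS I alpha ->
  dfamily SS (fun e => if e 0%N \in I then alpha (e 0%N) else x0).
Proof.
move=> [oI _ da] j; have [_ dj] := da j.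
apply: (@dpred_ext _ _ _ (fun e =>
  [set row_mx (const_mx t : 'rV_1) (chart j (alpha t)) | t in [set t | t \in I /\ dom j (alpha t)]]
    (row_mx (\row_(i < 1) e (dim j + 0)%N) (\row_(i < dim j) e i)) \/
  ~ (e (dim j + 0)%N \in I) /\ (dom j x0 /\ chart j x0 = \row_(i < dim j) e i))).
  move=> e; split.
    move=> [[t [tI tj] /eq_row_mx[/rowP/(_ ord0)]]|[/negP/negPf -> //]].
    by rewrite !mxE => <- <-; rewrite tI.
  case: ifPn => [eI [ej <-]|/negP eI]; last by right.
  left; exists (e (dim j + 0)%N) => //; congr row_mx.
  by apply/rowP => i; rewrite !mxE.
apply: dpred_or.
  apply: (dpred_set_row_mx (f := fun i e => e (dim j + 0)%N) (g := fun i e => e i) dj)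
    => i; exact: dvar.
apply: dpred_and.
  case: I {dj da} oI => lo hi oI.
  apply: (@dpred_ext _ _ _ (fun e =>
    ~ (beyond lo (e (dim j + 0)%N) /\ beyond hi (e (dim j + 0)%N)))).
    by move=> e; rewrite (mem_open_itv _ oI.1); split=> n h; apply: n; apply/andP.
  by apply/dpred_not/dpred_and; exact: dpred_beyond.
by apply: dpred_and; [exact: dpred_cst|exact: dpred_eq_row].
Qed.

Lemma expansion_curve_limit (g : M -> X) E : dfamily SS (fun e => g (e 0%N)) ->
  exists l : X, g @ near_end E --> l.
Proof.
move=> dg; have [c _] := omin_inhabited oM.
pose J j := `[< near_end E (fun t => dom j (g t)) >].
have nJ j : ~~ J j -> near_end E (fun t => ~ dom j (g t)).
  move=> /asboolPn nj.
  by have [] := @dpred_tame _ _ _ oS (fun t => dom j (g t)) (dfamily_dom j dg) E.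
have [j0 Ej0] := near_chart oS E dg.
pose h j (i : 'I_(dim j)) t := if pselect (dom j (g t)) then chart j (g t) ord0 i else c.
(* The coordinates are only [SS]-definable, but [K] consists of ends in the common order, which is
   why the boxes are definable in [MM]. *)
have hK j (i : 'I_(dim j)) := limit_end oS E (coord_definable i c dg).
pose K j (i : 'I_(dim j)) := projT1 (cid (hK j i)).
have KP j (i : 'I_(dim j)) w : beyond (K j i) w ->
    near_end E (fun t => dom j (g t) -> end_nbh (K j i) w (chart j (g t) ord0 i)).
  rewrite /K; case: cid => k hk /hk; apply: filterS => t /=.
  by case: pselect.
have ne w : params_ok K w -> exists x, in_box J K w x.
  move=> hw; suff /filter_ex[t] : near_end E (fun t => in_box J K w (g t)) by exists (g t).
  suff h' j : near_end E (fun t => if J j then dom j (g t) /\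
      forall i, end_nbh (K j i) (w j i) (chart j (g t) ord0 i) else ~ dom j (g t)).
    exact: filter_forall _ h'.
  case Jj: (J j); last by apply: nJ; rewrite Jj.
  have Ej : near_end E (fun t => dom j (g t)) by apply/asboolP; exact: Jj.
  have Ei : near_end E (fun t => forall i, dom j (g t) ->
      end_nbh (K j i) (w j i) (chart j (g t) ord0 i)).
    exact: filter_forall _ (fun i => KP j i _ (hw j i)).
  by apply: filterS2 Ej Ei => t tj h'; split=> // i; exact: h'.
have [l hl] := cluster_point oM dM hX cX skM (asboolT Ej0 : J j0) ne.
have [w0 hw0] : exists w, params_ok K w.
  by exists (fun j i => projT1 (cid (beyond_ex oM (K j i)))) => j i; case: cid.
have [j _ lj] : (\bigcup_j dom j) l by rewrite dom_cover.
(* The open set [dom j] meets a box, and boxes avoid all charts outside [J]. *)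
have Jj : J j.
  have [x jx /(_ j)] := hl _ (dom_open j) lj w0 hw0.
  by case: (J j) => // /(_ jx).
have Ej := asboolW Jj.
exists l; apply: (cvg_chart _ lj Ej) => i r u ul.
have lim_i w : beyond (K j i) w -> (forall y, end_nbh (K j i) w y -> olt r u y) ->
    near_end E (fun t => olt r u (chart j (g t) ord0 i)).
  by move=> /KP; move=> h1 h2; apply: filterS2 Ej h1 => t tj /(_ tj)/h2.
pose at_l : Prop := if K j i is BSide s a then a = chart j l ord0 i else False.
have : at_l.
  apply: contrapT => nK.
  have [|w hw [r' [u' [u'l sep]]]] := @separate_end (K j i) (chart j l ord0 i).
    by move: nK; rewrite /at_l; case: (K j i).
  (* Only the parameter of the coordinate [i] in chart [j] is changed, to the separating value
     [w]. *)
  pose w' j' (i' : 'I_(dim j')) := 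
    if pselect (Tagged (fun j => 'I_(dim j)) i' = Tagged _ i) then w else w0 j' i'.
  have hw' : params_ok K w'.
    move=> j' i'; rewrite /w'; case: pselect => [e|n] /=; last exact: hw0.
    by have -> : K j' i' = K j i := congr1 (fun p => K _ (tagged p)) e.
  have w'E : w' j i = w by rewrite /w'; case: pselect => // n; case: n.
  have [x [jx ux] /(_ j)] := hl _ (open_chart_olt i r' u') (conj lj u'l) w' hw'.
  rewrite Jj => -[_ /(_ i)]; rewrite w'E.
  exact: sep.
rewrite /at_l; case Ki: (K j i) => [s a|//] aE; rewrite -{}aE in ul.
rewrite Ki in lim_i.
(* If [u] is on the side opposite to the approach, the weak inequality with [a] suffices; otherwise
   [u] itself serves as parameter. *)
have [rs|/neq_negb rs] := eqVneq r s; rewrite {}rs in ul lim_i *.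
  have [w aw] := olt_unbounded oM s a; apply: (lim_i w aw) => y /andP[ay _].
  exact: olt_le_trans ay.
rewrite oltN in ul.
by apply: (lim_i u ul) => y /andP[_]; rewrite oltN.
Qed.

End CurvesInExpansion.

Theorem proposition4p8 (d : Order.disp_t) (M : orderTopologicalType d)
    (MM SS : structure M) (X : charted_space M) :
  o_minimal MM -> o_minimal SS -> expansion MM SS ->
  has_definable_skolem MM ->
  definable_space MM X -> hausdorff_space X ->
  (definably_compact MM X <-> definably_compact SS X).
Proof.
move=> oM oS MS skM dM hX; split=> cX I alpha; last first.
  (* An [MM]-definable curve is also [SS]-definable, and completability does not depend on the
     structure. *)
  move=> [oI ca da]; apply: cX; split=> // j.
  by have [? ?] := da j; split; exact: MS.
case: I => lo hi dalpha; have [oI _ _] := dalpha.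
have [c cI] := open_itv_ex oM oI.
(* The constant [alpha c] extends the curve outside the interval, without effect on limits at its
   ends. *)
have lim E : near_end E (fun t => t \in Interval lo hi) ->
    exists l : X, alpha @ near_end E --> l.
  move=> EI; have FF := near_end_filter oM E.
  have [l hl] := expansion_curve_limit oM oS skM dM hX cX E
    (g := fun t => if t \in Interval lo hi then alpha t else alpha c)
    (dfamily_curve (alpha c) dalpha).
  exists l => U /hl gU; suff : near_end E (alpha @^-1` U) by [].
  by apply: filterS2 EI gU => t /= ->.
rewrite -(mem_open_itv _ oI.1) in cI.
split; [rewrite (at_left_endE oM oI)|rewrite (at_right_endE oM oI)]; apply: lim.
  by rewrite -(at_left_endE oM oI); exists c => // t [].
by rewrite -(at_right_endE oM oI); exists c => // t [].
Qed.
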